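(* Let $K$ be a field, let $(\Sigma,\mathbb{M})$ be a once-punctured closed surface of positive genus, let $n$ be a positive integer and let $x\in K$ be any scalar. If $\tau$ and $\sigma$ are triangulations of $(\Sigma,\mathbb{M})$ related by the flip of an arc $k\in\tau$, then the quivers with potential $(Q(\tau),S(\tau,x,n))$ and $(Q(\sigma),S(\sigma,x,n))$ are related by the mutation of quivers with potential $\mu_k$; that is, $\mu_k(Q(\tau),S(\tau,x,n))$ and $(Q(\sigma),S(\sigma,x,n))$ are right-equivalent.
   Context: **Surfaces and triangulations.** A once-punctured closed surface $(\Sigma,\mathbb{M})$ is a compact connected oriented two-dimensional real manifold $\Sigma$ with empty boundary together with a one-point set $\mathbb{M}=\{p\}\subset\Sigma$. An arc is a curve in $\Sigma$ with endpoints in $\mathbb{M}$, otherwise disjoint from $\mathbb{M}$, without self-intersections except that its endpoints coincide, and not cutting out an unpunctured monogon; arcs are considered up to isotopy relative to $\mathbb{M}$. A triangulation is a maximal collection of pairwise distinct arcs that can be realized with pairwise disjoint interiors; it cuts $\Sigma$ into triangles, each having three distinct sides. The flip of $k\in\tau$ replaces $k$ by the unique arc $k'\ne k$ such that $\sigma=(\tau\setminus\{k\})\cup\{k'\}$ is a triangulation; the vertex $k$ of $Q(\tau)$ is identified with the vertex $k'$ of $Q(\sigma)$. **The quiver and the potential.** The vertices of $Q(\tau)$ are the arcs of $\tau$; for each triangle $\triangle$ and each ordered pair $(i,j)$ of sides of $\triangle$ with $j$ directly following $i$ clockwise inside $\triangle$, there is an arrow $i\to j$ (so arrows correspond to corners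 of triangles, and there are no oriented 2-cycles). Each triangle gives an oriented 3-cycle. For an arrow $\alpha$, exactly two arrows start at its terminal vertex: $f(\alpha)$ denotes the one in the same triangle as $\alpha$, and $g(\alpha)$ the other one. Paths are composed from right to left. Since there is one puncture, all arrows form one $g$-orbit, of size $m$ say, and $\mathcal{G}(p)=g^{m-1}(\alpha)\cdots g(\alpha)\alpha$ ($\alpha$ any arrow; well defined up to rotation) is the cycle running around the puncture. Let $T(\tau)$ be the sum of the 3-cycles arising from the triangles, one 3-cycle $f^2(\alpha)f(\alpha)\alpha$ (up to rotation) for each triangle, and put $S(\tau,x,n)=T(\tau)+x\,\mathcal{G}(p)^n$. **Potentials.** For a finite loop-free quiver $Q$, $K\langle\langle Q\rangle\rangle=\prod_{\ell\ge 0}A^{(\ell)}$ is the complete path algebra, with $A^{(\ell)}$ the $K$-span of paths of length $\ell$; $R=A^{(0)}$ and $\mathfrak m=\prod_{\ell\ge1}A^{(\ell)}$. A potential is a possibly infinite $K$-linear combination of cycles of positive length. Potentials $S,W$ are cyclically equivalent ($S\sim_{\rm cyc}W$) if $S-W$ lies in the $\mathfrak m$-adic closure of the span of all $a_1\cdots a_\ell-a_2\cdots a_\ell a_1$, with $a_1\cdots a_\ell$ a cycle. A quiver with potential (QP) is a pair $(Q,S)$, with $S$ considered up to cyclical equivalence. A right-equivalence $(Q,S)\to(Q',S')$ between QPs with the same vertex set is a ring isomorphism $\varphi:K\langle\langle Q\rangle\rangle\to K\langle\langle Q'\rangle\rangle$ with $\varphi|_R=\mathrm{id}_R$ and $\varphi(S)\sim_{\rm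 cyc}S'$. **Mutations (Derksen–Weyman–Zelevinsky).** The reduced part of a QP $(Q,S)$ with $S\in\mathfrak m^2$ is a QP $(Q_{\rm red},S_{\rm red})$ with $S_{\rm red}\in\mathfrak m^3$ such that $(Q,S)$ is right-equivalent to the direct sum (same vertices, union of arrow sets, sum of potentials) of $(Q_{\rm red},S_{\rm red})$ and a trivial QP (one whose potential lies in $A^{(2)}$ and whose cyclic derivatives span the space of arrows); it exists and is unique up to right-equivalence. Let $k$ be a vertex of $Q$ not on any 2-cycle. The premutation $\widetilde\mu_k(Q,S)$ is obtained by replacing each arrow $a$ incident to $k$ by a reversed arrow $a^*$, adding for each path $bc$ with $c:i\to k$, $b:k\to j$ an arrow $[bc]:i\to j$, and, after replacing $S$ by a cyclically equivalent potential with no cycle starting at $k$, taking the potential $[S]+\sum c^*b^*[bc]$, where $[S]$ is obtained by replacing each factor $bc$ through $k$ by $[bc]$ and the sum runs over all such paths $bc$. The mutation $\mu_k(Q,S)$ is the reduced part of $\widetilde\mu_k(Q,S)$, well defined up to right-equivalence. *)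

(* Defs.v *)
From HB Require Import structures.
From mathcomp Require Import all_boot all_order all_algebra.
From mathcomp Require Import boolp.

Set Implicit Arguments.
Unset Strict Implicit.
Unset Printing Implicit Defensive.

Import GRing.Theory.
Local Open Scope ring_scope.

(** * Quivers and complete path algebras *)

Record quiver (V : finType) := Quiver {
  arrow :> finType;
  src : arrow -> V;
  tgt : arrow -> V }.

(** A path is a pair [(v, s)] of its starting vertex and the list [s] of its
    arrows _in the order in which they are traversed_; thus [(v, [::])] is the
    trivial path at [v], and the path written [c b a] from right to left is
    [(src a, [:: a; b; c])]. *)

Fixpoint walk (V : finType) (Q : quiver V) (v : V) (s : seq Q) : bool :=
  if s is a :: s' then (src a == v) && walk (tgt a) s' else true.

Definition wend (V : finType) (Q : quiver V) (v : V) (s : seq Q) : V :=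
  last v (map (@tgt V Q) s).

Definition is_cycle (V : finType) (Q : quiver V) (v : V) (s : seq Q) : bool :=
  [&& s != [::], walk v s & wend v s == v].

Definition loop_free (V : finType) (Q : quiver V) : Prop :=
  forall a : Q, src a != tgt a.

Definition no_2cycle_at (V : finType) (Q : quiver V) (k : V) : Prop :=
  forall a b : Q, src a = k -> tgt b = k -> tgt a != src b.

(** [K<<Q>>]: since a finite quiver has finitely many paths of each length, an
    element of the product of the [A^(l)] is an arbitrary family of
    coefficients indexed by all paths. *)

Record cpalg (K : fieldType) (V : finType) (Q : quiver V) := CPAlg {
  coef :> V -> seq Q -> K;
  coef_off : forall v s, ~~ walk v s -> coef v s = 0 }.

Section CompletePathAlgebra.
Context {K : fieldType} {V : finType} {Q : quiver V}.
Implicit Types (x y z : cpalg K Q) (v : V) (s : seq Q).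

Lemma cpalgP x y : (forall v s, x v s = y v s) -> x = y.
Proof.
case: x y => [f fP] [g gP] /= fg.
have {}fg : f = g by apply/funext => v; apply/funext => s; apply: fg.
by rewrite -fg in gP *; congr CPAlg; apply: Prop_irrelevance.
Qed.

Lemma series_off (f : V -> seq Q -> K) v s :
  ~~ walk v s -> (if walk v s then f v s else 0) = 0.
Proof. by move=> /negbTE ->. Qed.

(** The formal sum of [f v s] times [(v, s)] over all paths [(v, s)]. *)
Definition series (f : V -> seq Q -> K) : cpalg K Q := CPAlg (series_off f).

Lemma walk_cat v s t : walk v (s ++ t) = walk v s && walk (wend v s) t.
Proof. by elim: s v => //= a s IHs v; rewrite IHs andbA. Qed.

Lemma wend_cat v s t : wend v (s ++ t) = wend (wend v s) t.
Proof. by rewrite /wend map_cat last_cat. Qed.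

HB.instance Definition _ := gen_eqMixin (cpalg K Q).
HB.instance Definition _ := gen_choiceMixin (cpalg K Q).

Definition cp_zero : cpalg K Q := series (fun _ _ => 0).
Definition cp_opp x : cpalg K Q := series (fun v s => - x v s).
Definition cp_add x y : cpalg K Q := series (fun v s => x v s + y v s).
Definition cp_scale (c : K) x : cpalg K Q := series (fun v s => c * x v s).
Definition cp_one : cpalg K Q := series (fun _ s => (s == [::])%:R).

(** Composition from right to left: in [x * y] the factor [y] is traversed
    first. *)
Definition cp_mul x y : cpalg K Q := series (fun v s =>
  \sum_(0 <= i < (size s).+1) x (wend v (take i s)) (drop i s) * y v (take i s)).

Lemma cp_addE x y v s : cp_add x y v s = x v s + y v s.
Proof. by rewrite /=; case: ifPn => // h; rewrite !coef_off ?addr0. Qed.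
Lemma cp_oppE x v s : cp_opp x v s = - x v s.
Proof. by rewrite /=; case: ifPn => // h; rewrite !coef_off ?oppr0. Qed.
Lemma cp_zeroE v s : cp_zero v s = 0.
Proof. by rewrite /= if_same. Qed.
Lemma cp_scaleE c x v s : cp_scale c x v s = c * x v s.
Proof. by rewrite /=; case: ifPn => // h; rewrite !coef_off ?mulr0. Qed.
Lemma cp_oneE v s : cp_one v s = (s == [::])%:R.
Proof. by rewrite /=; case: ifPn => //; case: s. Qed.
Lemma cp_mulE x y v s : cp_mul x y v s =
  \sum_(0 <= i < (size s).+1) x (wend v (take i s)) (drop i s) * y v (take i s).
Proof.
rewrite /=; case: ifPn => // h; rewrite big1_seq // => i _.
move: h; rewrite -{1}(cat_take_drop i s) walk_cat negb_and.
by case/orP=> h; rewrite (coef_off _ h) ?mulr0 ?mul0r.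
Qed.

Fact cp_addA : associative cp_add.
Proof. by move=> x y z; apply: cpalgP => v s; rewrite !cp_addE addrA. Qed.
Fact cp_addC : commutative cp_add.
Proof. by move=> x y; apply: cpalgP => v s; rewrite !cp_addE addrC. Qed.
Fact cp_add0 : left_id cp_zero cp_add.
Proof. by move=> x; apply: cpalgP => v s; rewrite cp_addE cp_zeroE add0r. Qed.
Fact cp_addN : left_inverse cp_zero cp_opp cp_add.
Proof.
by move=> x; apply: cpalgP => v s; rewrite cp_addE cp_oppE addNr cp_zeroE.
Qed.

HB.instance Definition _ :=
  GRing.isZmodule.Build (cpalg K Q) cp_addA cp_addC cp_add0 cp_addN.

Fact cp_mulA : associative cp_mul.
Proof.
move=> x y z; apply: cpalgP => v s; rewrite !cp_mulE.
pose F j i := x (wend v (take i s)) (drop i s)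
  * (y (wend v (take j s)) (take (i - j) (drop j s)) * z v (take j s)).
transitivity (\sum_(0 <= i < (size s).+1) \sum_(0 <= j < (size s).+1 | (j <= i)%N)
    F j i).
  apply: eq_big_nat => i /andP[_ les]; rewrite ltnS in les.
  rewrite cp_mulE big_distrr /= size_takel //.
  rewrite (big_nat_widen _ _ (size s).+1) //=.
  apply: eq_bigr => j; rewrite ltnS => leji; rewrite /F take_takel //.
  congr (_ * (y _ _ * _)).
  by rewrite take_drop subnK.
rewrite (exchange_big_dep_nat xpredT) //.
apply: eq_big_nat => j /andP[_ les]; rewrite ltnS in les.
rewrite cp_mulE big_distrl /= size_drop.
transitivity (\sum_(j <= i < (size s).+1) F j i).
  by rewrite [RHS](big_nat_widenl _ 0).
rewrite -{1}[j]add0n big_addn subSn //.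
apply: eq_big_nat => i _; rewrite /F addnK mulrA drop_drop.
have -> : take (i + j) s = take j s ++ take i (drop j s) by rewrite addnC takeD.
by rewrite wend_cat.
Qed.

Fact cp_mul1 : left_id cp_one cp_mul.
Proof.
move=> x; apply: cpalgP => v s; rewrite cp_mulE big_nat_recr //.
rewrite drop_size take_size cp_oneE mul1r big_nat big1 => [|i].
  exact: add0r.
move=> /andP[_ lt_is].
by rewrite cp_oneE -size_eq0 size_drop subn_eq0 leqNgt lt_is mul0r.
Qed.

Fact cp_mulr1 : right_id cp_one cp_mul.
Proof.
move=> x; apply: cpalgP => v s; rewrite cp_mulE big_nat_recl //.
rewrite take0 drop0 cp_oneE mulr1 big_nat big1 => [|i]; first exact: addr0.
by rewrite cp_oneE; case: s => // a s _; rewrite mulr0.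
Qed.

Fact cp_mulDl : left_distributive cp_mul +%R.
Proof.
move=> x y z; apply: cpalgP => v s; rewrite [RHS]cp_addE !cp_mulE -big_split /=.
by apply: eq_bigr => i _; rewrite -mulrDl -[in RHS]cp_addE.
Qed.

Fact cp_mulDr : right_distributive cp_mul +%R.
Proof.
move=> x y z; apply: cpalgP => v s; rewrite [RHS]cp_addE !cp_mulE -big_split /=.
by apply: eq_bigr => i _; rewrite -mulrDr -[in RHS]cp_addE.
Qed.

HB.instance Definition _ := GRing.Zmodule_isPzRing.Build (cpalg K Q)
  cp_mulA cp_mul1 cp_mulr1 cp_mulDl cp_mulDr.

Fact cp_scaleA (a b : K) x : cp_scale a (cp_scale b x) = cp_scale (a * b) x.
Proof. by apply: cpalgP => v s; rewrite !cp_scaleE mulrA. Qed.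
Fact cp_scale1 : left_id 1 cp_scale.
Proof. by move=> x; apply: cpalgP => v s; rewrite cp_scaleE mul1r. Qed.
Fact cp_scaleDr : right_distributive cp_scale +%R.
Proof.
move=> a x y; apply: cpalgP => v s.
by rewrite [RHS]cp_addE !cp_scaleE cp_addE mulrDr.
Qed.
Fact cp_scaleDl x : {morph cp_scale^~ x : a b / a + b}.
Proof.
by move=> a b; apply: cpalgP => v s; rewrite [RHS]cp_addE !cp_scaleE mulrDl.
Qed.

HB.instance Definition _ := GRing.Zmodule_isLmodule.Build K (cpalg K Q)
  cp_scaleA cp_scale1 cp_scaleDr cp_scaleDl.

End CompletePathAlgebra.

(** The path [(v, s)] as an element of [K<<Q>>] ([0] if [(v, s)] is not a
    path). *)
Definition pth (K : fieldType) (V : finType) (Q : quiver V) (v : V) (s : seq Q) :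
    cpalg K Q :=
  series (fun w t => ((w, t) == (v, s))%:R).

(** The element of [R = A^(0)] with coefficient [c v] at the trivial path at
    [v]; every element of [R] is of this form. *)
Definition vertex_elt (K : fieldType) (V : finType) (Q : quiver V) (c : V -> K) :
    cpalg K Q :=
  series (fun v s => if s is [::] then c v else 0).

(** [x] lies in the [d]-th power of the ideal [m]. *)
Definition in_mpow (K : fieldType) (V : finType) (Q : quiver V) (d : nat)
    (x : cpalg K Q) : Prop :=
  forall v s, (size s < d)%N -> x v s = 0.

(** [x] lies in [A^(l)]. *)
Definition homogeneous (K : fieldType) (V : finType) (Q : quiver V) (l : nat)
    (x : cpalg K Q) : Prop :=
  forall v s, size s != l -> x v s = 0.

(** * Potentials and right-equivalence *)

Definition is_potential (K : fieldType) (V : finType) (Q : quiver V)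
    (S : cpalg K Q) : Prop :=
  forall v s, ~~ is_cycle v s -> S v s = 0.

(** The linear span of the [a_1 ... a_l - a_2 ... a_l a_1]; here [a = a_1] is
    the arrow that [a_1 ... a_l] traverses last. *)
Inductive cyc_span (K : fieldType) (V : finType) (Q : quiver V) :
    cpalg K Q -> Prop :=
| cyc_span0 : cyc_span 0
| cyc_spanD (c : K) (v : V) (s : seq Q) (a : Q) (x : cpalg K Q) :
    is_cycle v (rcons s a) -> cyc_span x ->
    cyc_span (c *: (pth K v (rcons s a) - pth K (src a) (a :: s)) + x).

Definition cyc_equiv (K : fieldType) (V : finType) (Q : quiver V)
    (S W : cpalg K Q) : Prop :=
  forall d : nat, exists2 c, cyc_span c & in_mpow d (S - W - c).

Record QP (K : fieldType) (V : finType) := MkQP {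
  qp_quiver :> quiver V;
  qp_pot : cpalg K qp_quiver;
  qp_potP : is_potential qp_pot }.

Definition right_equiv (K : fieldType) (V : finType) (P P' : QP K V) : Prop :=
  exists phi : {rmorphism cpalg K P -> cpalg K P'},
    [/\ bijective phi,
        forall c : V -> K, phi (vertex_elt P c) = vertex_elt P' c
      & cyc_equiv (phi (qp_pot P)) (qp_pot P')].

(** [reindex h S] substitutes backwards: the coefficient of a path [t] of [Q']
    is the coefficient in [S] of the path of [Q] obtained from [t] by replacing
    each arrow [b] by the path [h b], and it is [0] if [t] contains an arrow [b]
    with [h b = None]. *)
Definition reindex (K : fieldType) (V : finType) (Q Q' : quiver V)
    (h : Q' -> option (seq Q)) (S : cpalg K Q) : cpalg K Q' :=
  series (fun v t =>
    if all (fun b => isSome (h b)) t then S v (flatten (pmap h t)) else 0).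

Section PotentialFacts.
Context {K : fieldType} {V : finType} {Q : quiver V}.
Implicit Types (S W : cpalg K Q).

Lemma pot0 : is_potential (0 : cpalg K Q).
Proof. by move=> v s _; apply: cp_zeroE. Qed.

Lemma potD S W : is_potential S -> is_potential W -> is_potential (S + W).
Proof. by move=> hS hW v s h; rewrite [LHS]cp_addE hS ?hW ?addr0. Qed.

Lemma potZ c S : is_potential S -> is_potential (c *: S).
Proof. by move=> hS v s h; rewrite [LHS]cp_scaleE hS ?mulr0. Qed.

Lemma pot_sum (J : Type) (r : seq J) (P : pred J) (F : J -> cpalg K Q) :
  (forall i, P i -> is_potential (F i)) -> is_potential (\sum_(i <- r | P i) F i).
Proof. by move=> hF; apply: big_ind => //; [exact: pot0 | exact: potD]. Qed.

Lemma pot_pth v (s : seq Q) : is_cycle v s -> is_potential (pth K v s).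
Proof.
move=> hs w t; rewrite /pth /=; case: ifP => // _.
by case: eqP => [[-> ->]|//]; rewrite hs.
Qed.

Lemma potM S W : is_potential S -> is_potential W -> is_potential (S * W).
Proof.
move=> hS hW v s; apply: contraNeq; rewrite [X in X != 0]cp_mulE => nz.
have [i nzi] : exists i, S (wend v (take i s)) (drop i s) * W v (take i s) != 0.
  case: (pselect (exists i, S (wend v (take i s)) (drop i s) * W v (take i s) != 0)).
    by [].
  move=> hno; case/negP: nz; rewrite big1 // => i _.
  by apply/eqP/negPn/negP => h; apply: hno; exists i.
have cW : is_cycle v (take i s).
  by apply: contraNT nzi => h; rewrite hW ?mulr0.
have cS : is_cycle (wend v (take i s)) (drop i s).
  by apply: contraNT nzi => h; rewrite hS ?mul0r.
rewrite -(cat_take_drop i s) /is_cycle walk_cat wend_cat.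
case/and3P: cW => nW -> /eqP eW; case/and3P: cS => _ -> /eqP; rewrite !eW => ->.
by rewrite eqxx !andbT; case: (take i s) nW.
Qed.

Lemma potX S (n : nat) : (0 < n)%N -> is_potential S -> is_potential (S ^+ n).
Proof.
case: n => // n _ hS; elim: n => [|n IHn]; first by rewrite expr1.
by rewrite exprS; apply: potM.
Qed.

Lemma pot_reindex (Q' : quiver V) (h : Q' -> option (seq Q)) S :
  (forall b s, h b = Some s -> s != [::] /\ wend (src b) s = tgt b) ->
  is_potential S -> is_potential (reindex h S).
Proof.
move=> hh hS v t; rewrite /reindex /=; case: ifP => // wt.
case: ifP => // ht nt; apply: hS; apply: contraNN nt.
have endE : wend v (flatten (pmap h t)) = wend v t.
  elim: t v wt ht => //= b t IHt v /andP[/eqP <- wt].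
  case hb: (h b) => [u|//] /= ht; have [nu eu] := hh _ _ hb.
  by rewrite wend_cat eu IHt.
rewrite /is_cycle wt endE => /and3P[ne _ ->]; rewrite andbT /=.
by case: (t) ne.
Qed.

End PotentialFacts.

(** * Reduced parts *)

Section DirectSum.
Context {K : fieldType} {V : finType}.

Definition quiver_sum (Q Q' : quiver V) : quiver V :=
  @Quiver V (Q + Q')%type
    (fun a => match a with inl b => src b | inr b => src b end)
    (fun a => match a with inl b => tgt b | inr b => tgt b end).

Definition as_left (Q Q' : quiver V) (a : quiver_sum Q Q') : option (seq Q) :=
  if a is inl b then Some [:: b] else None.
Definition as_right (Q Q' : quiver V) (a : quiver_sum Q Q') : option (seq Q') :=
  if a is inr b then Some [:: b] else None.

Lemma qp_sumP (P P' : QP K V) : is_potential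
  (reindex (@as_left P P') (qp_pot P) + reindex (@as_right P P') (qp_pot P')).
Proof.
apply: potD; (apply: pot_reindex; last exact: qp_potP); by case=> b s // [<-].
Qed.

Definition qp_sum (P P' : QP K V) : QP K V := MkQP (@qp_sumP P P').

(** The cyclic derivative of [S] with respect to [a]: a cycle
    [a_1 ... a_l] contributes [a_(i+1) ... a_l a_1 ... a_(i-1)] for each [i]
    with [a_i = a].  Hence the coefficient of a path [s] is the sum of the
    coefficients in [S] of all rotations of the cycle closing up [s] by [a],
    one for each possible position of [a]. *)
Definition cyc_deriv (Q : quiver V) (a : Q) (S : cpalg K Q) : cpalg K Q :=
  series (fun v s =>
    if v == tgt a then
      \sum_(i < (size s).+1)
         let r := rot i (a :: s) in S (src (head a r)) r
    else 0).

Definition trivial_qp (T : QP K V) : Prop :=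
  homogeneous 2 (qp_pot T) /\
  forall x : cpalg K T, homogeneous 1 x <->
    exists c : T -> K, x = \sum_(a : T) c a *: cyc_deriv a (qp_pot T).

Definition reduced_part (P Pred : QP K V) : Prop :=
  [/\ in_mpow 2 (qp_pot P),
      in_mpow 3 (qp_pot Pred)
    & exists2 T : QP K V, trivial_qp T & right_equiv P (qp_sum Pred T)].

End DirectSum.

(** * Mutation *)

Section Mutation.
Context {K : fieldType} {V : finType}.
Context (Q : quiver V) (k : V).

Definition arrow_off := {a : Q | (src a != k) && (tgt a != k)}.
Definition arrow_in := {c : Q | tgt c == k}.
Definition arrow_out := {b : Q | src b == k}.

(** Used only when there is no loop at [k], so that [arrow_in] and [arrow_out]
    are disjoint. *)
Definition premut_arrow : finType :=
  (arrow_off + (arrow_out * arrow_in) + (arrow_out + arrow_in))%type.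

Definition pm_off (a : arrow_off) : premut_arrow := inl (inl a).
Definition pm_comp (b : arrow_out) (c : arrow_in) : premut_arrow :=
  inl (inr (b, c)).
Definition pm_star_out (b : arrow_out) : premut_arrow := inr (inl b).
Definition pm_star_in (c : arrow_in) : premut_arrow := inr (inr c).

Definition premut_src (e : premut_arrow) : V :=
  match e with
  | inl (inl a) => src (val a)
  | inl (inr (b, c)) => src (val c)
  | inr (inl b) => tgt (val b)
  | inr (inr c) => tgt (val c)
  end.
Definition premut_tgt (e : premut_arrow) : V :=
  match e with
  | inl (inl a) => tgt (val a)
  | inl (inr (b, c)) => tgt (val b)
  | inr (inl b) => src (val b)
  | inr (inr c) => src (val c)
  end.

Definition premut_quiver : quiver V := Quiver premut_src premut_tgt.

(** Composite arrows [[bc]] are expanded back to [b c]. *)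
Definition expand (e : premut_quiver) : option (seq Q) :=
  match e with
  | inl (inl a) => Some [:: val a]
  | inl (inr (b, c)) => Some [:: val c; val b]
  | inr _ => None
  end.

Definition premut_pot (S : cpalg K Q) : cpalg K premut_quiver :=
  reindex expand S +
  \sum_(b : arrow_out) \sum_(c : arrow_in)
     pth K (src (val c)) ([:: pm_comp b c; pm_star_out b; pm_star_in c] :
                            seq premut_quiver).

Lemma premut_potP (S : cpalg K Q) : is_potential S -> is_potential (premut_pot S).
Proof.
move=> hS; apply: potD.
  by apply: pot_reindex hS; case=> [[a|[b c]]|//] s [<-].
apply: pot_sum => b _; apply: pot_sum => c _; apply: pot_pth.
by rewrite /is_cycle /= !eqxx /= (eqP (valP b)) (eqP (valP c)) eqxx.
Qed.

(** No cycle occurring in [S] starts at [k]. *)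
Definition avoids_start (S : cpalg K Q) : Prop := forall s, S k s = 0.

End Mutation.

(** [P'] is (a representative of) the mutation of [P] at [k]. *)
Definition is_mutation (K : fieldType) (V : finType) (k : V) (P P' : QP K V) :
    Prop :=
  [/\ loop_free P, no_2cycle_at P k
    & exists (S : cpalg K P) (hS : is_potential S),
        [/\ cyc_equiv (qp_pot P) S, avoids_start k S
          & reduced_part (MkQP (premut_potP (k := k) hS)) P']].

(** * Triangulations of once-punctured closed surfaces *)

(** A triangulation of the once-punctured closed oriented surface of genus [g]
    is given by the gluing pattern of the triangles into which it cuts the
    surface.  Each arc [i] has two sides [(i, false)] and [(i, true)], and each
    side lies in exactly one triangle. *)

Definition side (I : finType) : finType := (I * bool)%type.
Definition opp (I : finType) (s : side I) : side I := (s.1, ~~ s.2).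

(** [cw s] is the side that directly follows [s] clockwise inside the triangle
    containing [s], so the triangles are the orbits of [cw]; turning around the
    punctures permutes the corners, a corner being the one between [s] and
    [cw s], by [opp \o cw], so the punctures are the orbits of [opp \o cw]. *)
Record triangulation (g : nat) (I : finType) := Triangulation {
  cw : side I -> side I;
  cw3 : forall s, cw (cw (cw s)) = s;
  cw_arc : forall s, (cw s).1 != s.1;
  one_puncture : fcard (@opp I \o cw) (side I) = 1%N;
  euler_char : (* V + F + 2g = E + 2 *)
    (fcard (@opp I \o cw) (side I) + fcard cw (side I) + 2 * g = #|I| + 2)%N }.

Section Flip.
Context {g : nat} {I : finType}.
Implicit Types (tau sigma : triangulation g I) (k : I).

(** The side that follows [s] clockwise inside the region containing [s] of the
    surface cut along all arcs but [k]. *)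
Definition cw_without tau k (s : side I) : side I :=
  if (cw tau s).1 == k then cw tau (opp (cw tau s)) else cw tau s.

Definition relabel k (b : bool) (s : side I) : side I :=
  if s.1 == k then (k, b (+) s.2) else s.

(** [sigma] is obtained from [tau] by replacing the arc [k] by an arc [k'], which
    is again labelled [k]: the remaining arcs are the same, with the same sides,
    i.e. they cut the surface in the same way, and [k'] is not [k], i.e. [sigma]
    is not [tau] (which of the two sides of [k'] is called [(k, false)] is
    arbitrary). *)
Definition flip k tau sigma : Prop :=
  (forall s : side I, s.1 != k -> cw_without tau k s = cw_without sigma k s) /\
  ~ (exists b, forall s, cw sigma (relabel k b s) = relabel k b (cw tau s)).

End Flip.

Section SurfaceQP.
Context {K : fieldType} {g : nat} {I : finType}.
Context (tau : triangulation g I).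

(** The arrow [s] is the corner between the sides [s] and [cw s]. *)
Definition surface_quiver : quiver I :=
  @Quiver I (side I) (fun s => s.1) (fun s => (cw tau s).1).

Definition arrow_f (a : surface_quiver) : surface_quiver := cw tau a.
Definition arrow_g (a : surface_quiver) : surface_quiver := opp (cw tau a).

(** [froots] selects one arrow in each orbit, i.e. one in each triangle. *)
Definition surface_T : cpalg K surface_quiver :=
  \sum_(a : surface_quiver | froots arrow_f a)
     pth K (src a) [:: a; arrow_f a; arrow_f (arrow_f a)].

(** The cycle around the puncture, which traverses all arrows, written starting
    with the arrow [a]; changing [a] rotates it. *)
Definition surface_G (a : surface_quiver) : cpalg K surface_quiver :=
  pth K (src a) (traject arrow_g a #|surface_quiver|).

Definition surface_S (x : K) (n : nat) (a : surface_quiver) :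
    cpalg K surface_quiver :=
  surface_T + x *: surface_G a ^+ n.

Lemma surface_SP (x : K) (n : nat) (a : surface_quiver) :
  (0 < n)%N -> is_potential (surface_S x n a).
Proof.
move=> hn; apply: potD.
  apply: pot_sum => b _; apply: pot_pth.
  by rewrite /is_cycle /= /wend /= /arrow_f cw3 !eqxx.
apply: potZ; apply: potX => //; apply: pot_pth.
have inj : injective arrow_g.
  have injcw : injective (cw tau).
    by move=> s t e; rewrite -(cw3 tau s) e cw3.
  by move=> s t [/eqP e1 /negb_inj e2]; apply: injcw; apply/eqP/andP; rewrite e2.
have ordE : order arrow_g a = #|surface_quiver|.
  have sym : connect_sym (frel arrow_g) by apply: fconnect_sym.
  have [r hr] := mem_card1 (one_puncture tau).
  have root1 c : froot arrow_g c = r.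
    by apply/eqP; have := hr (froot arrow_g c); rewrite !inE (roots_root sym).
  by apply: eq_card => b; rewrite !inE -(root_connect sym) !root1 eqxx.
have walkE (m : nat) b : walk (src b) (traject arrow_g b m).
  elim: m b => //= m IHm b; rewrite eqxx /=; exact: IHm (arrow_g b).
have endE (m : nat) b v : wend v (traject arrow_g b m.+1) = src (iter m.+1 arrow_g b).
  elim: m b v => // m IHm b v; rewrite [RHS]/= -iterS iterSr.
  exact: (IHm (arrow_g b) (tgt b)).
rewrite /is_cycle walkE -ordE.
have : (0 < order arrow_g a)%N by apply: order_gt0.
by case E: (order arrow_g a) => [|m] // _; rewrite endE -E iter_order // E !eqxx.
Qed.

Definition surface_QP (x : K) (n : nat) (hn : (0 < n)%N) (a : surface_quiver) :
    QP K I :=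
  MkQP (@surface_SP x n a hn).

End SurfaceQP.

(* Main.v *)
From HB Require Import structures.
From mathcomp Require Import all_boot all_order all_algebra.
From mathcomp Require Import boolp.
Require Import Defs.

Set Implicit Arguments.
Unset Strict Implicit.
Unset Printing Implicit Defensive.

Import GRing.Theory.
Local Open Scope ring_scope.

(** Write the two triangles of [tau] at [k] clockwise as [k_c, p_c, q_c], for
    [c] in [bool]; the sides of the quadrilateral that remains when [k] is
    removed are, in clockwise order, [p_0, q_0, p_1, q_1]. The new arc has sides
    [r_c], and the triangles of [sigma] at it are [r_c, q_(1-c), p_c]; all other
    triangles are common to [tau] and [sigma] ([flip_quadrilateral]). Name
    arrows by the sides at which the corresponding corners start.

    In the premutation the composite arrow [A_c = [k_c q_c]] and the arrow [p_c]
    form a 2-cycle. The other two composites [[k_(1-c) q_c]] play the role of the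
    arrows [q_c] of [Q(sigma)], and the reversed arrows [k_c^*] and [q_c^*] those
    of [p_c] and [r_(1-c)]. Hence the premutation has the arrows of [Q(sigma)]
    and the four arrows [A_c], [p_c] ([premut_to_sum]). With
    [u_c = q_c^* k_c^*], the path of [Q(sigma)] that runs parallel to [p_c], its
    potential is
      [sum_c (p_c + u_c) A_c + Y + x G(p_0, p_1)^n]    ([premut_image]),
    where [Y] is the sum of the 3-cycles of [Q(sigma)] and [G] is the cycle
    around the puncture, which passes through each [p_c] once because there is
    only one puncture. The cycle of [sigma] is [G(u_0, u_1)], because the corner
    of the quadrilateral between [p_c] and [q_c] is cut by the new arc.

    The change of variables [p_c -> p_c - u_c] turns this into
      [sum_c p_c A_c + Y + x G(p_0 - u_0, p_1 - u_1)^n].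
    The two signs in each factor of the power cancel, so [G(-u_0, -u_1) = G(u_0, u_1)], and
    every further term of the expansion contains some [p_c], which can be
    rotated to the front: the last summand is cyclically equivalent to
    [x G(u_0, u_1)^n + x sum_c p_c F_c] with [F_c] free of the [A_c]
    ([telescope]). So the change of variables [A_c -> A_c - x F_c] leaves
    [sum_c p_c A_c], a trivial potential, plus [S(sigma, x, n)]
    ([premut_equiv]). Both changes of variables alter some arrows by terms in
    the other arrows, hence are automorphisms ([triangular_automorphism]). *)

(* Coefficients are computed by the rewriting rules below, not by unfolding. *)
Arguments coef : simpl never.
Arguments vertex_elt : simpl never.
Arguments pth : simpl never.
Arguments series : simpl never.

(** * Coefficients, paths and the filtration by powers of the arrow ideal *)

Section Coefficients.
Context {K : fieldType} {V : finType} {Q : quiver V}.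
Implicit Types (x y z : cpalg K Q) (v w : V) (s t : seq Q) (a b : Q).

Lemma cp_coefD x y v s : (x + y) v s = x v s + y v s.
Proof. exact: cp_addE. Qed.
Lemma cp_coefN x v s : (- x) v s = - x v s.
Proof. exact: cp_oppE. Qed.
Lemma cp_coefB x y v s : (x - y) v s = x v s - y v s.
Proof. by rewrite cp_coefD cp_coefN. Qed.
Lemma cp_coef0 v s : (0 : cpalg K Q) v s = 0.
Proof. exact: cp_zeroE. Qed.
Lemma cp_coefZ c x v s : (c *: x) v s = c * x v s.
Proof. exact: cp_scaleE. Qed.
Lemma cp_coef1 v s : (1 : cpalg K Q) v s = (s == [::])%:R.
Proof. exact: cp_oneE. Qed.
Lemma cp_coefM x y v s : (x * y) v s =
  \sum_(0 <= i < (size s).+1) x (wend v (take i s)) (drop i s) * y v (take i s).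
Proof. exact: cp_mulE. Qed.

Lemma cp_coef_sum (J : Type) (r : seq J) (P : pred J) (F : J -> cpalg K Q) v s :
  (\sum_(i <- r | P i) F i) v s = \sum_(i <- r | P i) F i v s.
Proof. by apply: (big_morph (fun x => x v s)) => [x y|]; rewrite (cp_coefD, cp_coef0). Qed.

Lemma coef_pth v s w t : pth K v s w t = (walk v s && ((w, t) == (v, s)))%:R.
Proof.
by rewrite /pth /coef /=; case: eqP => [[-> ->]|]; case: ifP; rewrite ?andbT ?andbF // => ->.
Qed.

Lemma coef_vertex (c : V -> K) v s :
  vertex_elt Q c v s = if s is [::] then c v else 0.
Proof. by rewrite /coef; case: s => //= a s; rewrite if_same. Qed.

Lemma scaleE c x : c *: x = vertex_elt Q (fun=> c) * x.
Proof.
apply: cpalgP => v s; rewrite cp_coefZ cp_coefM big_nat_recr //= big_nat big1 ?add0r.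
  by rewrite take_size drop_size coef_vertex.
move=> i /andP[_ lti]; rewrite coef_vertex.
case E: (drop i s) (size_drop i s) => [|b u]; last by rewrite mul0r.
by move/esym/eqP; rewrite subn_eq0 leqNgt lti.
Qed.

Lemma cp_coefM_vertex x (c : V -> K) v s : (x * vertex_elt Q c) v s = c v * x v s.
Proof.
rewrite cp_coefM big_nat_recl //= big_nat big1 ?addr0.
  by rewrite take0 drop0 coef_vertex mulrC.
by move=> i /andP[_ lti]; rewrite coef_vertex; case: s lti => //= a s _; rewrite mulr0.
Qed.

Lemma cp_scaleAl c x y : (c *: x) * y = c *: (x * y).
Proof. by rewrite !scaleE mulrA. Qed.

Lemma cp_scaleAr c x y : x * (c *: y) = c *: (x * y).
Proof.
apply: cpalgP => v s; rewrite cp_coefZ !cp_coefM big_distrr /=.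
by apply: eq_bigr => i _; rewrite cp_coefZ mulrCA.
Qed.

Definition arr a : cpalg K Q := pth K (src a) [:: a].

Lemma pth_off v s : ~~ walk v s -> pth K v s = 0.
Proof.
by move=> h; apply: cpalgP => w t; rewrite coef_pth (negbTE h) cp_coef0.
Qed.

Lemma pthM v s w t :
  pth K w t * pth K v s = if wend v s == w then pth K v (s ++ t) else 0.
Proof.
apply: cpalgP => u r; rewrite cp_coefM.
pose c : K := [&& walk w t, walk v s, wend v s == w & (u, r) == (v, s ++ t)]%:R.
transitivity (\sum_(0 <= i < (size r).+1 | i == size s) c).
  rewrite [RHS]big_mkcond; apply: eq_big_nat => i /andP[_]; rewrite ltnS => lei.
  rewrite !coef_pth -natrM mulnb /c -!pair_eqE /=; case: (i =P size s) => [->|ne].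
    congr ((nat_of_bool _)%:R); apply/idP/idP.
      case/andP=> /andP[-> /andP[/eqP e1 /eqP e2]] /and3P[-> /eqP eu /eqP e3].
      by rewrite -eu -[X in wend u X]e3 e1 -{1}(cat_take_drop (size s) r) e3 e2 !eqxx.
    case/and5P=> -> -> /eqP e1 /eqP -> /eqP ->.
    by rewrite take_size_cat // drop_size_cat // e1 !eqxx.
  suff /negbTE-> : take i r != s by rewrite !andbF.
  by apply/eqP=> es; apply: ne; rewrite -es size_takel.
rewrite big_nat1_eq /=; case: ifP => hs.
  case: ifP => e; rewrite ?coef_pth ?cp_coef0 /c e ?andbF //=.
  by rewrite walk_cat (eqP e) [walk v s && walk w t]andbC -andbA.
case: ifP; rewrite ?cp_coef0 // coef_pth => _; case: eqP; rewrite ?andbF // => -[_ er].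
by move: hs; rewrite er ltnS size_cat leq_addr.
Qed.

Lemma pth_cons a s : pth K (src a) (a :: s) = pth K (tgt a) s * arr a.
Proof. by rewrite pthM eqxx. Qed.

Lemma pth0E v : pth K v [::] = vertex_elt Q (fun w => (w == v)%:R).
Proof.
apply: cpalgP => w s; rewrite coef_pth coef_vertex -pair_eqE /=.
by case: s => [|a s]; rewrite ?andbT ?andbF.
Qed.

(** ** The filtration *)

Lemma in_mpow0 d : in_mpow d (0 : cpalg K Q).
Proof. by move=> v s _; rewrite cp_coef0. Qed.
Lemma in_mpowD d x y : in_mpow d x -> in_mpow d y -> in_mpow d (x + y).
Proof. by move=> hx hy v s h; rewrite cp_coefD hx ?hy ?addr0. Qed.
Lemma in_mpowZ d c x : in_mpow d x -> in_mpow d (c *: x).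
Proof. by move=> hx v s h; rewrite cp_coefZ hx ?mulr0. Qed.
Lemma in_mpowN d x : in_mpow d x -> in_mpow d (- x).
Proof. by move=> hx v s h; rewrite cp_coefN hx ?oppr0. Qed.
Lemma in_mpowB d x y : in_mpow d x -> in_mpow d y -> in_mpow d (x - y).
Proof. by move=> hx hy; apply/in_mpowD/in_mpowN. Qed.
Lemma in_mpow_sum d (J : Type) (r : seq J) (P : pred J) (F : J -> cpalg K Q) :
  (forall i, P i -> in_mpow d (F i)) -> in_mpow d (\sum_(i <- r | P i) F i).
Proof. by move=> hF; apply: big_ind => //; [exact: in_mpow0 | exact: in_mpowD]. Qed.
Lemma in_mpowM d e x y : in_mpow d x -> in_mpow e y -> in_mpow (d + e) (x * y).
Proof.
move=> hx hy v s h; rewrite cp_coefM big1_seq // => i.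
rewrite mem_index_iota /= ltnS => lei; case: (ltnP i e) => hi.
  by rewrite hy ?mulr0 // size_takel.
by rewrite hx ?mul0r // size_drop ltn_subLR // addnC (leq_trans h) // leq_add2l.
Qed.
Lemma in_mpow_all0 x : (forall d, in_mpow d x) -> x = 0.
Proof. by move=> h; apply: cpalgP => v s; rewrite (h (size s).+1) ?cp_coef0. Qed.

(** ** Splitting off the first arrow *)

Definition const_part x : cpalg K Q := vertex_elt Q (fun v => x v [::]).

(** The factor [y] in front of [a] in [x = x_0 + ... + y * a + ...]. *)
Definition left_quot a x : cpalg K Q :=
  series (fun v s => if v == tgt a then x (src a) (a :: s) else 0).

Lemma coef_left_quot a x v s :
  left_quot a x v s = if v == tgt a then x (src a) (a :: s) else 0.
Proof.
rewrite {1}/coef /=; case: ifPn => // h; case: eqP => // e.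
by rewrite coef_off //= eqxx -e.
Qed.

Lemma left_quotD a x y : left_quot a (x + y) = left_quot a x + left_quot a y.
Proof.
apply: cpalgP => v s; rewrite cp_coefD !coef_left_quot; case: ifP => _.
  exact: cp_coefD.
by rewrite addr0.
Qed.

Lemma left_quot_vertex a c : left_quot a (vertex_elt Q c) = 0.
Proof.
by apply: cpalgP => v s; rewrite coef_left_quot coef_vertex if_same cp_coef0.
Qed.

(** A path of [x * y] starts with an arrow of [y], unless its factor from [y] is
    trivial. *)
Lemma left_quotM a x y :
  left_quot a (x * y) = y (src a) [::] *: left_quot a x + x * left_quot a y.
Proof.
apply: cpalgP => v s; rewrite cp_coefD cp_coefZ !coef_left_quot.
rewrite [(x * left_quot a y) v s]cp_coefM; case: ifP => [/eqP->|ne].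
  rewrite cp_coefM big_nat_recl //= mulrC; congr (_ + _).
  by apply: eq_bigr => i _; rewrite coef_left_quot eqxx.
by rewrite big1 ?mulr0 ?addr0 // => i _; rewrite coef_left_quot ne mulr0.
Qed.

Lemma left_quot_arr a b :
  left_quot a (arr b) = if a == b then pth K (tgt a) [::] else 0.
Proof.
apply: cpalgP => v s; rewrite coef_left_quot coef_pth /= eqxx /= -pair_eqE /=.
rewrite eqseq_cons; case: (a =P b) => [->|_]; last by rewrite andbF cp_coef0 if_same.
by rewrite eqxx coef_pth /= -pair_eqE /=; case: (v == _).
Qed.

(** Induction along this decomposition replaces sums over all paths: modulo the
    [d]-th power of the arrow ideal, [d] steps suffice. *)
Lemma left_quot_sum x : x = const_part x + \sum_a left_quot a x * arr a.
Proof.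
apply: cpalgP => v s; rewrite cp_coefD coef_vertex cp_coef_sum.
case: s => [|a s].
  rewrite big1 ?addr0 // => b _.
  by rewrite cp_coefM big_nat1 coef_pth -pair_eqE /= !andbF mulr0.
rewrite add0r.
have E b : (left_quot b x * arr b) v (a :: s) = if b == a then x v (a :: s) else 0.
  rewrite cp_coefM big_nat_recl //= coef_pth -pair_eqE /= !andbF mulr0 add0r.
  rewrite big_nat_recl //= take0 drop0 big_nat big1 ?addr0; last first.
    move=> i /andP[_ lti]; rewrite coef_pth /= -pair_eqE /= eqseq_cons.
    by case: s lti => //= c s _; rewrite !andbF mulr0.
  rewrite coef_pth -pair_eqE /= eqxx eqseq_cons andbT coef_left_quot /wend /=.
  case: (a =P b) => [->|ne]; last by rewrite andbF mulr0 eq_sym; case: eqP ne.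
  rewrite !eqxx andbT; case: (v =P src b) => [->|ne]; first by rewrite mulr1.
  by rewrite mulr0 coef_off //= negb_and; case: eqP => // e; case: ne.
by rewrite (eq_bigr _ (fun b _ => E b)) -big_mkcond big_pred1_eq.
Qed.

End Coefficients.

(** * Endpoints and supports *)

Section Supports.
Context {K : fieldType} {V : finType} {Q : quiver V}.
Implicit Types (x y z : cpalg K Q) (v w : V) (s t : seq Q) (a b : Q).

(** [x] lies in [e_w A e_v]. *)
Definition from_to v w x : Prop :=
  forall u s, x u s != 0 -> u = v /\ wend u s = w.

Definition supported (B : pred Q) x : Prop := forall v s, x v s != 0 -> all B s.

Lemma cp_coefM_neq0 x y v s : (x * y) v s != 0 ->
  exists i, x (wend v (take i s)) (drop i s) != 0 /\ y v (take i s) != 0.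
Proof.
rewrite cp_coefM => nz; case: (pselect (exists i, x (wend v (take i s)) (drop i s) != 0 /\
  y v (take i s) != 0)) => // no; case/negP: nz; rewrite big1 // => i _.
case: (x (wend v (take i s)) (drop i s) =P 0) => [->|/eqP hx]; first by rewrite mul0r.
case: (y v (take i s) =P 0) => [->|/eqP hy]; first by rewrite mulr0.
by case: no; exists i.
Qed.

Lemma from_to0 v w : from_to v w 0.
Proof. by move=> u s; rewrite cp_coef0 eqxx. Qed.

Lemma from_toD v w x y : from_to v w x -> from_to v w y -> from_to v w (x + y).
Proof.
move=> hx hy u s; rewrite cp_coefD => nz.
case: (x u s =P 0) => [x0|/eqP]; last exact: hx.
by apply: hy; move: nz; rewrite x0 add0r.
Qed.

Lemma from_toZ v w c x : from_to v w x -> from_to v w (c *: x).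
Proof.
by move=> hx u s nz; apply: hx; move: nz; rewrite cp_coefZ;
  apply: contra_neq => ->; rewrite mulr0.
Qed.

Lemma from_toN v w x : from_to v w x -> from_to v w (- x).
Proof. by rewrite -scaleN1r; apply: from_toZ. Qed.

Lemma from_toM u v w x y : from_to v w x -> from_to u v y -> from_to u w (x * y).
Proof.
move=> hx hy u' s /cp_coefM_neq0[i [/hx[_ ex] /hy[eu _]]]; split=> //.
by rewrite -ex -wend_cat cat_take_drop.
Qed.

Lemma from_to_pth v s : from_to v (wend v s) (pth K v s).
Proof.
move=> u t; rewrite coef_pth; case: ((u, t) =P (v, s)) => [[-> ->] //|_]; by rewrite andbF eqxx.
Qed.

Lemma from_to_arr a : from_to (src a) (tgt a) (arr a : cpalg K Q).
Proof. exact: (@from_to_pth (src a) [:: a]). Qed.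

Lemma from_to_in_m v w x : v != w -> from_to v w x -> in_mpow 1 x.
Proof.
move=> nvw hx u [|//] _; case: (x u [::] =P 0) => // /eqP /hx[eu ew].
by case/eqP: nvw; rewrite -eu -ew.
Qed.

Lemma from_to_mul_vertex v w x c : from_to v w x -> x * vertex_elt Q c = c v *: x.
Proof.
move=> hx; apply: cpalgP => u s; rewrite cp_coefM_vertex cp_coefZ.
by case: (x u s =P 0) => [->|/eqP/hx[-> _]]; rewrite ?mulr0.
Qed.

Lemma from_to_idl v w x : from_to v w x -> pth K w [::] * x = x.
Proof.
move=> hx; apply: cpalgP => u s; rewrite cp_coefM big_nat_recr //= big_nat big1.
  rewrite add0r take_size drop_size coef_pth -pair_eqE /= andbT.
  by case: (x u s =P 0) => [->|/eqP/hx[_ ->]]; rewrite ?mulr0 // eqxx mul1r.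
move=> i /andP[_ lti]; rewrite coef_pth -pair_eqE /= -[drop i s == _]size_eq0.
by rewrite size_drop subn_eq0 leqNgt lti andbF mul0r.
Qed.

Lemma supported0 B : supported B 0.
Proof. by move=> u s; rewrite cp_coef0 eqxx. Qed.

Lemma supportedD B x y : supported B x -> supported B y -> supported B (x + y).
Proof.
move=> hx hy u s; rewrite cp_coefD => nz.
case: (x u s =P 0) => [x0|/eqP]; last exact: hx.
by apply: (hy u); move: nz; rewrite x0 add0r.
Qed.

Lemma supportedZ B c x : supported B x -> supported B (c *: x).
Proof.
by move=> hx u s nz; apply: (hx u); move: nz; rewrite cp_coefZ; apply: contra_neq => ->;
  rewrite mulr0.
Qed.

Lemma supportedN B x : supported B x -> supported B (- x).
Proof. by rewrite -scaleN1r; apply: supportedZ. Qed.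

Lemma supportedM B x y : supported B x -> supported B y -> supported B (x * y).
Proof.
move=> hx hy u s /cp_coefM_neq0[i [/hx ex /hy ey]].
by rewrite -(cat_take_drop i s) all_cat ey.
Qed.

Lemma supported_pth (B : pred Q) v s : all B s -> supported B (pth K v s).
Proof.
move=> hs u t; rewrite coef_pth; case: ((u, t) =P (v, s)) => [[_ ->] //|_]; by rewrite andbF eqxx.
Qed.

Lemma supported_left_quot B a x : supported B x -> supported B (left_quot a x).
Proof.
by move=> hx u s; rewrite coef_left_quot; case: ifP => [_ /hx/andP[]//|_]; rewrite eqxx.
Qed.

Lemma supported_left_quot0 (B : pred Q) a x : ~~ B a -> supported B x -> left_quot a x = 0.
Proof.
move=> na hx; apply: cpalgP => u s; rewrite coef_left_quot cp_coef0; case: ifP => // _.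
by case: (x (src a) (a :: s) =P 0) => // /eqP/hx/andP[]; rewrite (negbTE na).
Qed.

End Supports.

(** * Substitution homomorphisms *)

Definition fixes_vertices (K : fieldType) (V : finType) (Q Q' : quiver V)
    (phi : cpalg K Q -> cpalg K Q') : Prop :=
  forall c : V -> K, phi (vertex_elt Q c) = vertex_elt Q' c.

Section Substitution.
Context {K : fieldType} {V : finType} {Q Q' : quiver V}.
Variable F : Q -> cpalg K Q'.
Hypothesis F_from_to : forall a, from_to (src a) (tgt a) (F a).
Hypothesis F_in_m : forall a, in_mpow 1 (F a).
Implicit Types (x y : cpalg K Q).

(** As [F a] lies in the arrow ideal, paths with [d] or more arrows do not affect
    the value of the substitution modulo the [d]-th power of this ideal. *)
Fixpoint approx_subst d x : cpalg K Q' :=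
  if d is d'.+1 then
    vertex_elt Q' (fun v => x v [::]) + \sum_a approx_subst d' (left_quot a x) * F a
  else 0.

Definition subst x : cpalg K Q' := series (fun v s => approx_subst (size s).+1 x v s).

Lemma in_mpow_sumF d (f : Q -> cpalg K Q') :
  (forall a, in_mpow d (f a)) -> in_mpow d.+1 (\sum_a f a * F a).
Proof. by move=> hf; apply: in_mpow_sum => a _; rewrite -addn1; apply: in_mpowM. Qed.

Lemma approx_substS d x : in_mpow d (approx_subst d.+1 x - approx_subst d x).
Proof.
elim: d x => [|d IHd] x; first by move=> v s.
rewrite [approx_subst d.+2 x]/= [approx_subst d.+1 x]/= opprD addrACA subrr add0r.
rewrite -sumrB; under eq_bigr do rewrite -mulrBl.
by apply: in_mpow_sumF => a; apply: IHd.
Qed.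

Lemma subst_approx d x : in_mpow d (subst x - approx_subst d x).
Proof.
move=> v s hs.
have -> : (subst x - approx_subst d x) v s
    = (approx_subst (size s).+1 x - approx_subst d x) v s.
  rewrite !cp_coefB /subst /series {1}/coef; case: ifPn => // h.
  by rewrite !coef_off.
rewrite -(subnKC hs); move: (d - _)%N => e.
elim: e => [|e IHe]; first by rewrite addn0 subrr cp_coef0.
set X := approx_subst _ x in IHe *; set Y := approx_subst _ x in IHe.
rewrite addnS (_ : X - _ = (X - Y) - (approx_subst ((size s).+1 + e).+1 x - Y)).
  by rewrite cp_coefB IHe approx_substS ?subr0 // addSn ltnS leq_addr.
by rewrite opprB addrA subrK.
Qed.

(** Comparing coefficients, this equation determines [subst]; all properties of
    [subst] follow from it by induction on the length of paths. *)
Lemma substE x : subst x = vertex_elt Q' (fun v => x v [::])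
  + \sum_a subst (left_quot a x) * F a.
Proof.
apply/eqP; rewrite -subr_eq0; apply/eqP/in_mpow_all0 => d.
case: d => [|d]; first by move=> v s.
rewrite -[X in in_mpow _ (X - _)](subrK (approx_subst d.+1 x)) -addrA.
apply: in_mpowD; first exact: subst_approx.
rewrite /= opprD addrACA subrr add0r -sumrB; under eq_bigr do rewrite -mulrBl.
apply: in_mpow_sumF => a; rewrite -opprB; apply/in_mpowN/subst_approx.
Qed.

Lemma substD x y : subst (x + y) = subst x + subst y.
Proof.
apply/eqP; rewrite -subr_eq0; apply/eqP/in_mpow_all0 => d.
elim: d x y => [|d IHd] x y; first by move=> v s.
rewrite [subst (x + y)]substE [subst x]substE [subst y]substE.
have -> : vertex_elt Q' (fun v => (x + y) v [::])
    = vertex_elt Q' (fun v => x v [::]) + vertex_elt Q' (fun v => y v [::]).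
  by apply: cpalgP => v [|a s]; rewrite cp_coefD !coef_vertex ?cp_coefD ?addr0.
rewrite addrACA opprD addrACA subrr add0r -big_split -sumrB /=.
have E a : subst (left_quot a (x + y)) * F a
    - (subst (left_quot a x) * F a + subst (left_quot a y) * F a)
    = (subst (left_quot a x + left_quot a y)
       - (subst (left_quot a x) + subst (left_quot a y))) * F a.
  by rewrite mulrBl mulrDl left_quotD.
by rewrite (eq_bigr _ (fun a _ => E a)); apply: in_mpow_sumF => a; apply: IHd.
Qed.

Lemma subst0 : subst 0 = 0.
Proof. by apply: (addIr (subst 0)); rewrite -substD !add0r. Qed.

Lemma subst_vertex c : subst (vertex_elt Q c) = vertex_elt Q' c.
Proof.
rewrite substE big1 ?addr0 => [|a _]; last by rewrite left_quot_vertex subst0 mul0r.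
by apply: cpalgP => v [|a s]; rewrite !coef_vertex.
Qed.

Lemma substZ c x : subst (c *: x) = c *: subst x.
Proof.
apply/eqP; rewrite -subr_eq0; apply/eqP/in_mpow_all0 => d.
elim: d x => [|d IHd] x; first by move=> v s.
rewrite [subst (c *: x)]substE [subst x]substE scalerDr.
have -> : vertex_elt Q' (fun v => (c *: x) v [::])
    = c *: vertex_elt Q' (fun v => x v [::]).
  by apply: cpalgP => v [|a s]; rewrite cp_coefZ !coef_vertex ?cp_coefZ ?mulr0.
rewrite opprD addrACA subrr add0r scaler_sumr -sumrB.
have E a : subst (left_quot a (c *: x)) * F a - c *: (subst (left_quot a x) * F a)
    = (subst (c *: left_quot a x) - c *: subst (left_quot a x)) * F a.
  rewrite mulrBl; congr (subst _ * _ - _); last by rewrite !scaleE mulrA.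
  apply: cpalgP => v s; rewrite cp_coefZ !coef_left_quot cp_coefZ.
  by case: ifP; rewrite ?mulr0.
by rewrite (eq_bigr _ (fun a _ => E a)); apply: in_mpow_sumF => a; apply: IHd.
Qed.

Lemma substM x y : subst (x * y) = subst x * subst y.
Proof.
apply/eqP; rewrite -subr_eq0; apply/eqP/in_mpow_all0 => d.
elim: d x y => [|d IHd] x y; first by move=> v s.
pose y0 := vertex_elt Q' (fun v => y v [::]).
(* [F a] starts at the source of [a], so only the constant term of [y] there
   matters. *)
have Ex : subst x * y0 = vertex_elt Q' (fun v => (x * y) v [::])
    + \sum_a (y (src a) [::] *: subst (left_quot a x)) * F a.
  rewrite [subst x]substE mulrDl mulr_suml; congr (_ + _).
    apply: cpalgP => v [|a s]; rewrite cp_coefM_vertex !coef_vertex ?mulr0 //.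
    by rewrite cp_coefM big_nat1 mulrC.
  apply: eq_bigr => a _; rewrite -mulrA (from_to_mul_vertex _ (@F_from_to a)).
  by rewrite cp_scaleAr cp_scaleAl.
rewrite [subst (x * y)]substE [subst y]substE mulrDr Ex -(addrA _ _ (subst x * _)) opprD addrACA.
rewrite subrr add0r mulr_sumr -big_split -sumrB /=.
have E a : subst (left_quot a (x * y)) * F a
    - ((y (src a) [::] *: subst (left_quot a x)) * F a
       + subst x * (subst (left_quot a y) * F a))
    = (subst (x * left_quot a y) - subst x * subst (left_quot a y)) * F a.
  rewrite left_quotM substD substZ mulrDl mulrBl mulrA opprD addrACA subrr.
  by rewrite add0r.
by rewrite (eq_bigr _ (fun a _ => E a)); apply: in_mpow_sumF => a; apply: IHd.
Qed.


Lemma subst_arr a : subst (arr a) = F a.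
Proof.
rewrite substE (_ : vertex_elt _ _ = 0) ?add0r; last first.
  apply: cpalgP => v [|b s]; rewrite coef_vertex cp_coef0 //.
  by rewrite coef_pth -pair_eqE /= !andbF.
rewrite (bigD1 a) //= big1 ?addr0 => [|b nba].
  by rewrite left_quot_arr eqxx pth0E subst_vertex -pth0E (from_to_idl (@F_from_to a)).
by rewrite left_quot_arr (negbTE nba) subst0 mul0r.
Qed.

(** The universal property of the complete path algebra. *)
Lemma subst_exists : exists phi : {rmorphism cpalg K Q -> cpalg K Q'},
  fixes_vertices phi /\ forall a, phi (arr a) = F a.
Proof.
have subst_add : zmod_morphism subst.
  by move=> x y; rewrite substD -scaleN1r substZ scaleN1r.
have subst_mul : monoid_morphism subst.
  split=> [|x y]; last exact: substM.
  have e1 (Q1 : quiver V) : (1 : cpalg K Q1) = vertex_elt Q1 (fun=> 1).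
    by apply: cpalgP => v [|a s]; rewrite cp_coef1 coef_vertex.
  by rewrite !e1 subst_vertex.
pose phiA := GRing.isZmodMorphism.Build _ _ subst subst_add.
pose phiM := GRing.isMonoidMorphism.Build _ _ subst subst_mul.
pose phi : {rmorphism cpalg K Q -> cpalg K Q'} := HB.pack subst phiA phiM.
by exists phi; split=> [c|a]; [exact: subst_vertex | exact: subst_arr].
Qed.

End Substitution.

Section Morphisms.
Context {K : fieldType} {V : finType} {Q Q' : quiver V}.
Implicit Types (x y : cpalg K Q).

Lemma morph_scale (phi : {rmorphism cpalg K Q -> cpalg K Q'}) c x :
  fixes_vertices phi -> phi (c *: x) = c *: phi x.
Proof. by move=> hphi; rewrite !scaleE rmorphM hphi. Qed.

(** A ring homomorphism that fixes the vertices and sends arrows into the arrow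
    ideal is continuous, hence is determined by its values on arrows. *)
Lemma morph_ext (B : pred Q) (phi psi : {rmorphism cpalg K Q -> cpalg K Q'}) :
  fixes_vertices phi -> fixes_vertices psi ->
  (forall a, B a -> in_mpow 1 (phi (arr a))) ->
  (forall a, B a -> phi (arr a) = psi (arr a)) ->
  forall x, supported B x -> phi x = psi x.
Proof.
move=> hphi hpsi hm hB x hx.
apply/eqP; rewrite -subr_eq0; apply/eqP/in_mpow_all0 => d.
elim: d x hx => [|d IHd] x hx; first by move=> v s.
rewrite (left_quot_sum x) !rmorphD hphi hpsi opprD addrACA subrr add0r.
rewrite !rmorph_sum -sumrB; apply: in_mpow_sum => a _; rewrite !rmorphM.
case: (boolP (B a)) => ha.
  rewrite -hB // -mulrBl -addn1; apply: in_mpowM (hm _ ha).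
  by apply: IHd; apply: supported_left_quot.
by rewrite (supported_left_quot0 ha hx) !rmorph0 !mul0r subrr; apply: in_mpow0.
Qed.

End Morphisms.

Lemma morph_pth (K : fieldType) (V : finType) (Q Q' : quiver V) (B : pred Q)
    (B' : pred Q') (phi : {rmorphism cpalg K Q -> cpalg K Q'}) :
  fixes_vertices phi ->
  (forall a, from_to (src a) (tgt a) (phi (arr a))) ->
  (forall a, B a -> supported B' (phi (arr a))) ->
  forall v s, from_to v (wend v s) (phi (pth K v s))
    /\ (all B s -> supported B' (phi (pth K v s))).
Proof.
move=> phi_v phi_ft phi_s v s; elim: s v => [|a s IHs] v.
  rewrite pth0E phi_v -pth0E; split; first exact: (@from_to_pth _ _ _ v [::]).
  by move=> _; apply: supported_pth.
case: (src a =P v) => [<-|/eqP ne].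
  rewrite pth_cons rmorphM; have [IH1 IH2] := IHs (tgt a); split.
    by apply: from_toM (phi_ft a); apply: IH1.
  by case/andP=> /phi_s ha /IH2 hs; apply: supportedM.
rewrite pth_off /= ?(negbTE ne) // rmorph0.
by split; [exact: from_to0 | move=> _; exact: supported0].
Qed.

Lemma arr_in_m (K : fieldType) (V : finType) (Q : quiver V) (a : Q) :
  in_mpow 1 (arr a : cpalg K Q).
Proof. by move=> v [|//] _; rewrite coef_pth -pair_eqE /= !andbF. Qed.

Lemma morph_cancel (K : fieldType) (V : finType) (Q Q' : quiver V)
    (phi : {rmorphism cpalg K Q -> cpalg K Q'})
    (psi : {rmorphism cpalg K Q' -> cpalg K Q}) :
  fixes_vertices phi -> fixes_vertices psi ->
  (forall a, psi (phi (arr a)) = arr a) -> cancel phi psi.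
Proof.
move=> phi_v psi_v e x; pose chi : {rmorphism _ -> _} := (psi \o phi)%FUN.
apply: (morph_ext (phi := chi) (psi := idfun) (B := predT)) => [c|c|a _|a _|v s _].
- by rewrite /= phi_v psi_v.
- by [].
- by rewrite /= e; apply: arr_in_m.
- by rewrite /= e.
- exact: all_predT.
Qed.

(** The added terms involve only arrows of [B], which are fixed, so subtracting
    them again gives the inverse. *)
Lemma triangular_automorphism (K : fieldType) (V : finType) (Q : quiver V)
    (B : pred Q) (D : Q -> cpalg K Q) :
  (forall a, from_to (src a) (tgt a) (D a)) -> (forall a, in_mpow 1 (D a)) ->
  (forall a, B a -> D a = 0) -> (forall a, supported B (D a)) ->
  exists phi : {rmorphism cpalg K Q -> cpalg K Q},
    [/\ bijective phi, fixes_vertices phi, forall a, phi (arr a) = arr a + D a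
      & forall x, supported B x -> phi x = x].
Proof.
move=> Dft Dm DB Ds.
have [phi [phi_v phi_a]] : exists phi : {rmorphism cpalg K Q -> cpalg K Q},
    fixes_vertices phi /\ forall a, phi (arr a) = arr a + D a.
  apply: subst_exists => a; first by apply: from_toD => //; apply: from_to_arr.
  by apply: in_mpowD => //; apply: arr_in_m.
have [psi [psi_v psi_a]] : exists psi : {rmorphism cpalg K Q -> cpalg K Q},
    fixes_vertices psi /\ forall a, psi (arr a) = arr a - D a.
  apply: subst_exists => a.
    by apply: from_toD; [exact: from_to_arr | exact: from_toN].
  by apply: in_mpowB => //; apply: arr_in_m.
have fixB (chi : {rmorphism cpalg K Q -> cpalg K Q}) x : fixes_vertices chi ->
    (forall a, B a -> chi (arr a) = arr a) -> supported B x -> chi x = x.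
  move=> chi_v chi_a; apply: (morph_ext (psi := idfun)) => // a ha.
  by rewrite chi_a //; apply: arr_in_m.
have phiB x : supported B x -> phi x = x.
  by apply: fixB => // a ha; rewrite phi_a DB ?addr0.
have psiB x : supported B x -> psi x = x.
  by apply: fixB => // a ha; rewrite psi_a DB ?subr0.
exists phi; split=> //; exists psi; apply: morph_cancel => // a.
  by rewrite phi_a rmorphD psi_a (psiB (D a)) // subrK.
by rewrite psi_a rmorphB phi_a (phiB (D a)) // addrK.
Qed.


(** * Cyclic equivalence *)

Section CyclicEquivalence.
Context {K : fieldType} {V : finType} {Q : quiver V}.
Implicit Types (x y z S W : cpalg K Q) (v w : V) (s t : seq Q) (a b : Q).

Lemma cyc_span_add x y : cyc_span x -> cyc_span y -> cyc_span (x + y).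
Proof.
move=> hx hy; elim: {x}hx => [|c v s a x h _ IH]; first by rewrite add0r.
by rewrite -addrA; apply: cyc_spanD.
Qed.

Lemma cyc_span_scale k x : cyc_span x -> cyc_span (k *: x).
Proof.
elim=> [|c v s a y h _ IH]; first by rewrite scaler0; apply: cyc_span0.
by rewrite scalerDr scalerA; apply: cyc_spanD.
Qed.

Lemma cyc_refl S : cyc_equiv S S.
Proof. by move=> d; exists 0; [exact: cyc_span0 | rewrite !subrr; exact: in_mpow0]. Qed.

Lemma cyc_sym S W : cyc_equiv S W -> cyc_equiv W S.
Proof.
move=> h d; have [c hc hd] := h d; exists (- c).
  by rewrite -scaleN1r; apply: cyc_span_scale.
by rewrite -(opprB S W) -opprD; apply: in_mpowN.
Qed.

Lemma cycD S S' W W' :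
  cyc_equiv S S' -> cyc_equiv W W' -> cyc_equiv (S + W) (S' + W').
Proof.
move=> h h' d; have [c hc hd] := h d; have [c' hc' hd'] := h' d; exists (c + c').
  exact: cyc_span_add.
by rewrite (opprD S') (addrACA S) (opprD c) (addrACA (S - S')); apply: in_mpowD.
Qed.

Lemma cyc_trans S S' S'' : cyc_equiv S S' -> cyc_equiv S' S'' -> cyc_equiv S S''.
Proof.
move=> h h' d; have [c hc hd] := h d; have [c' hc' hd'] := h' d; exists (c + c').
  exact: cyc_span_add.
rewrite (_ : S - S'' - _ = (S - S' - c) + (S' - S'' - c')); first exact: in_mpowD.
by rewrite [RHS]addrACA -opprD subrKA.
Qed.

Lemma cycZ k S W : cyc_equiv S W -> cyc_equiv (k *: S) (k *: W).
Proof.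
move=> h d; have [c hc hd] := h d; exists (k *: c); first exact: cyc_span_scale.
by rewrite -!scalerBr; apply: in_mpowZ.
Qed.

Lemma cyc_sum (J : Type) (r : seq J) (P : pred J) (F G : J -> cpalg K Q) :
  (forall i, P i -> cyc_equiv (F i) (G i)) ->
  cyc_equiv (\sum_(i <- r | P i) F i) (\sum_(i <- r | P i) G i).
Proof.
move=> h; elim: r => [|i r IH]; first by rewrite !big_nil; apply: cyc_refl.
rewrite !big_cons; case: ifP => // hi; apply: cycD => //; exact: h.
Qed.

(** Cyclic equivalence is defined by a closure, hence passes to limits. *)
Lemma cyc_limit S W :
  (forall d, exists S' W', [/\ cyc_equiv S' W', in_mpow d (S - S') & in_mpow d (W - W')]) ->
  cyc_equiv S W.
Proof.
move=> h d; have [S' [W' [hc hS hW]]] := h d; have [c sc hd] := hc d; exists c => //.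
rewrite (_ : _ - c = (S - S') - (W - W') + (S' - W' - c)).
  by apply: in_mpowD => //; apply: in_mpowB.
by rewrite opprD [X in _ = X + _]addrACA -opprD subrKA.
Qed.

Lemma cyc_rot v s t : is_cycle v (s ++ t) ->
  cyc_equiv (pth K v (s ++ t)) (pth K (wend v s) (t ++ s)).
Proof.
elim/last_ind: t v s => [|t a IHt] v s hc.
  by move: hc; rewrite cats0 => /and3P[_ _ /eqP->]; apply: cyc_refl.
have step : cyc_equiv (pth K v (s ++ rcons t a)) (pth K (src a) ((a :: s) ++ t)).
  move=> d; exists (1 *: (pth K v (rcons (s ++ t) a) - pth K (src a) (a :: s ++ t)) + 0).
    by apply: cyc_spanD; [rewrite rcons_cat | exact: cyc_span0].
  by rewrite scale1r addr0 -rcons_cat subrr; apply: in_mpow0.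
apply: cyc_trans step _.
have [hw ea ev] : [/\ walk v (s ++ t), src a = wend v (s ++ t) & tgt a = v].
  move: hc; rewrite -rcons_cat -cats1 => /and3P[_].
  rewrite (walk_cat v (s ++ t)) (wend_cat v (s ++ t)) => /and3P[h /eqP e _] /eqP.
  by rewrite e h.
have es : wend (src a) (a :: s) = wend v s by rewrite -ev.
have hc' : is_cycle (src a) ((a :: s) ++ t).
  move: hw; rewrite walk_cat => /andP[hs ht].
  apply/and3P; split=> //; first by rewrite walk_cat es /= eqxx ev hs ht.
  by rewrite wend_cat es -wend_cat ea.
apply: cyc_trans (IHt _ _ hc') _.
by rewrite es cat_rcons; apply: cyc_refl.
Qed.

(** Every series is a limit of finite combinations of the paths that occur in
    it. *)
Lemma path_approx (P : cpalg K Q -> Prop) x :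
  P 0 -> (forall y z, P y -> P z -> P (y + z)) ->
  (forall v s, x v s != 0 -> P (x v s *: pth K v s)) ->
  forall d, exists2 z, P z & in_mpow d (x - z).
Proof.
move=> P0 PD Ppth d.
exists (\sum_(l < d) \sum_(t : l.-tuple Q) \sum_v x v t *: pth K v t).
  apply: big_ind => // l _; apply: big_ind => // t _; apply: big_ind => // v _.
  by case: (x v t =P 0) => [->|/eqP/Ppth//]; rewrite scale0r.
move=> v s hs; rewrite cp_coefB !cp_coef_sum (bigD1 (Ordinal hs)) //=.
rewrite !cp_coef_sum (bigD1 (in_tuple s)) //= !cp_coef_sum (bigD1 v) //=.
have E w t : (x w t *: pth K w t) v s = if (v, s) == (w, t) then x v s else 0.
  rewrite cp_coefZ coef_pth; case: eqP => [[-> ->]|_]; last by rewrite andbF mulr0.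
  by rewrite andbT; case: (boolP (walk w t)) => h; rewrite ?mulr1 // coef_off ?mul0r.
rewrite E eqxx !big1 ?addr0 ?subrr //.
- move=> l nl; rewrite cp_coef_sum big1 // => t _; rewrite cp_coef_sum big1 // => w _.
  rewrite E; case: eqP => // -[_ es]; case/eqP: nl; apply: val_inj => /=.
  by rewrite es size_tuple.
- move=> t nt; rewrite cp_coef_sum big1 // => w _; rewrite E; case: eqP => // -[_ es].
  by case/eqP: nt; apply: val_inj.
- by move=> w nw; rewrite E; case: eqP => // -[ew]; rewrite ew eqxx in nw.
Qed.

(** For two paths this is a rotation, and both sides are bilinear and
    continuous. The end points matter: only closed paths can be rotated. *)
Lemma cyc_mulC v w x y : from_to v w x -> from_to w v y -> cyc_equiv (x * y) (y * x).
Proof.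
have cont (z z' : cpalg K Q) : forall P : cpalg K Q -> Prop,
  (forall y, P y -> cyc_equiv (y * z) (z * y)) ->
  (forall d, exists2 y, P y & in_mpow d (z' - y)) -> cyc_equiv (z' * z) (z * z').
  move=> P hP h; apply: cyc_limit => d; have [y0 /hP hy hd] := h d.
  exists (y0 * z), (z * y0); split=> //.
    by rewrite -mulrBl -[d]addn0; apply: in_mpowM.
  by rewrite -mulrBr -[d]add0n; apply: in_mpowM.
have lin z : forall y y', cyc_equiv (y * z) (z * y) -> cyc_equiv (y' * z) (z * y') ->
  cyc_equiv ((y + y') * z) (z * (y + y')).
  by move=> y1 y2 h1 h2; rewrite mulrDl mulrDr; apply: cycD.
have lin0 z : cyc_equiv (0 * z) (z * 0) by rewrite mul0r mulr0; apply: cyc_refl.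
move=> hx hy; apply: (cont y x (fun x => cyc_equiv (x * y) (y * x))) => //.
apply: path_approx => [||v1 s /hx[-> ews]]; [exact: lin0 | exact: lin |].
rewrite cp_scaleAl cp_scaleAr; apply: cycZ; apply: cyc_sym.
apply: (cont _ y (fun y => cyc_equiv (y * pth K v s) (pth K v s * y))) => //.
apply: path_approx => [||w1 t /hy[-> evt]]; [exact: lin0 | exact: lin |].
rewrite cp_scaleAl cp_scaleAr; apply: cycZ.
rewrite !pthM ews evt !eqxx; case: (boolP (walk v (s ++ t))) => hw; last first.
  rewrite (pth_off hw) pth_off; first exact: cyc_refl.
  by move: hw; rewrite !walk_cat ews evt andbC.
case: (s =P [::]) => [es|/eqP ns].
  by rewrite es cats0 -ews es; apply: cyc_refl.
rewrite -ews; apply: cyc_rot; rewrite /is_cycle hw wend_cat ews evt eqxx.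
by case: (s) ns.
Qed.

(** Write [(x y)^n = x ((y x)^(n-1) y)] and rotate [x] to the end. *)
Lemma cyc_mulC_exp v w x y n : (0 < n)%N -> from_to v w x -> from_to w v y ->
  cyc_equiv ((x * y) ^+ n) ((y * x) ^+ n).
Proof.
case: n => // n _ hx hy.
have E : (x * y) ^+ n.+1 = x * ((y * x) ^+ n * y).
  elim: n => [|n IHn]; first by rewrite expr0 mul1r.
  by rewrite exprS IHn exprS !mulrA.
rewrite E exprSr (mulrA _ y x); apply: (cyc_mulC hx).
elim: n {E} => [|n IHn]; first by rewrite expr0 mul1r.
by rewrite exprS -!mulrA; exact: from_toM hy (from_toM hx IHn).
Qed.

End CyclicEquivalence.

(** * Coding paths by paths *)

Section Reindexing.
Context {K : fieldType} {V : finType} {Q Q' : quiver V}.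
Variable h : Q' -> option (seq Q).
Implicit Types (S : cpalg K Q) (v : V) (t : seq Q') (b : Q').

Lemma coef_reindex S v t : reindex h S v t =
  if walk v t && all (fun b => isSome (h b)) t then S v (flatten (pmap h t)) else 0.
Proof. by rewrite {1}/coef /=; case: (walk v t). Qed.

Lemma reindexD S W : reindex h (S + W) = reindex h S + reindex h W.
Proof.
apply: cpalgP => v t; rewrite cp_coefD !coef_reindex; case: ifP => _.
  exact: cp_coefD.
by rewrite addr0.
Qed.

Lemma reindex0 : reindex h (0 : cpalg K Q) = 0.
Proof. by apply: cpalgP => v t; rewrite coef_reindex !cp_coef0 if_same. Qed.

Lemma reindexZ c S : reindex h (c *: S) = c *: reindex h S.
Proof.
apply: cpalgP => v t; rewrite cp_coefZ !coef_reindex; case: ifP => _.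
  exact: cp_coefZ.
by rewrite mulr0.
Qed.

Lemma reindex_sum (J : Type) (r : seq J) (P : pred J) (F : J -> cpalg K Q) :
  reindex h (\sum_(i <- r | P i) F i) = \sum_(i <- r | P i) reindex h (F i).
Proof. by apply: (big_morph (reindex h)); [exact: reindexD | exact: reindex0]. Qed.

(** [h] is a prefix code, so that a word in the [h b] can be decoded. *)
Definition path_code : Prop :=
  (forall b s, h b = Some s ->
     [/\ s != [::], walk (src b) s & wend (src b) s = tgt b]) /\
  (forall b b' s s' r r', h b = Some s -> h b' = Some s' ->
     s ++ r = s' ++ r' -> b = b').

Hypothesis h_code : path_code.

(** Decoding does not turn other words into paths: a code word is non-empty, so
    it shows where its letter starts. *)
Lemma walk_decode v t : all (fun b => isSome (h b)) t ->
  walk v (flatten (pmap h t)) = walk v t.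
Proof.
elim: t v => //= b t IHt v; case hb: (h b) => [s|//] /= ht.
have [ns ws es] := h_code.1 _ _ hb; rewrite walk_cat.
case: (src b =P v) => [<-|ne]; first by rewrite ws es IHt.
by case: s ns ws {hb es} => //= a s _ /andP[/eqP-> _]; case: eqP.
Qed.

Lemma wend_decode v t : all (fun b => isSome (h b)) t -> walk v t ->
  wend v (flatten (pmap h t)) = wend v t.
Proof.
elim: t v => //= b t IHt v; case hb: (h b) => [s|//] /= ht /andP[/eqP <- wt].
by have [_ _ es] := h_code.1 _ _ hb; rewrite wend_cat es IHt.
Qed.

Lemma decode_inj t t' : all (fun b => isSome (h b)) t ->
  all (fun b => isSome (h b)) t' ->
  flatten (pmap h t) = flatten (pmap h t') -> t = t'.
Proof.
have nil b s (X : seq Q) : h b = Some s -> [::] = s ++ X -> False.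
  by move=> /h_code.1[]; case: s.
elim: t t' => [|b t IHt] [|b' t'] //=.
- by case hb: (h b') => [s|//] /= _ _ /(nil _ _ _ hb).
- by case hb: (h b) => [s|//] /= _ _ /esym/(nil _ _ _ hb).
case hb: (h b) => [s|//] /=; case hb': (h b') => [s'|//] /= ht ht' e.
have eb := h_code.2 _ _ _ _ _ _ hb hb' e; move: hb' e; rewrite -eb hb => -[<-].
by move/(congr1 (drop (size s))); rewrite !drop_size_cat // => /IHt->.
Qed.

Lemma reindex_pth v t : all (fun b => isSome (h b)) t ->
  reindex h (pth K v (flatten (pmap h t))) = pth K v t.
Proof.
move=> ht; apply: cpalgP => w r; rewrite coef_reindex !coef_pth walk_decode //.
case: (boolP (walk w r)) => [wr|nwr] /=; last first.
  by case: ((w, r) =P (v, t)) => [[<- <-]|]; rewrite ?andbF // (negbTE nwr).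
case: ifP => hr; last first.
  by case: ((w, r) =P (v, t)) => [[_ er]|]; [rewrite er ht in hr | rewrite andbF].
congr ((nat_of_bool (_ && _))%:R); apply/idP/idP => /eqP[-> e].
  by rewrite (decode_inj hr ht e).
by rewrite e.
Qed.

End Reindexing.

Lemma renaming_isomorphism (K : fieldType) (V : finType) (Q Q' : quiver V)
    (rho : Q -> Q') :
  bijective rho -> (forall a, src (rho a) = src a) -> (forall a, tgt (rho a) = tgt a) ->
  exists phi : {rmorphism cpalg K Q -> cpalg K Q'},
    [/\ bijective phi, fixes_vertices phi,
        forall v s, phi (pth K v s) = pth K v (map rho s)
      & forall (Q0 : quiver V) (h : Q' -> option (seq Q0)) (S : cpalg K Q0),
          phi (reindex (h \o rho : Q -> _) S) = reindex h S].
Proof.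
move=> [theta rhoK thetaK] rho_src rho_tgt.
have wendE v (s : seq Q') : wend v (map theta s) = wend v s.
  by rewrite /wend -map_comp; congr last; apply: eq_map => a; rewrite /= -rho_tgt thetaK.
have walkE v (s : seq Q') : walk v (map theta s) = walk v s.
  elim: s v => //= a s IHs v; by rewrite -rho_src -rho_tgt thetaK IHs.
pose ren (x : cpalg K Q) : cpalg K Q' := series (fun v t => x v (map theta t)).
have renE x v t : ren x v t = x v (map theta t).
  by rewrite {1}/coef /=; case: ifPn => // nw; rewrite coef_off // walkE.
have ren_add : zmod_morphism ren.
  by move=> x y; apply: cpalgP => v t; rewrite cp_coefB !renE cp_coefB.
have ren_mul : monoid_morphism ren.
  split=> [|x y]; apply: cpalgP => v t.
    by rewrite renE !cp_coef1; case: t.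
  rewrite renE !cp_coefM size_map; apply: eq_bigr => i _.
  by rewrite !renE -map_take -map_drop wendE.
pose phiA := GRing.isZmodMorphism.Build _ _ ren ren_add.
pose phiM := GRing.isMonoidMorphism.Build _ _ ren ren_mul.
pose phi : {rmorphism cpalg K Q -> cpalg K Q'} := HB.pack ren phiA phiM.
have phiE x v s : phi x v (map rho s) = x v s by rewrite renE mapK.
have ext (y z : cpalg K Q') : (forall v s, y v (map rho s) = z v (map rho s)) -> y = z.
  move=> h; apply: cpalgP => v t; have := h v (map theta t).
  by rewrite -map_comp (eq_map (g := id)) ?map_id.
exists phi; split=> //; last first.
- move=> Q0 h S; apply: ext => v s; rewrite phiE !coef_reindex.
  rewrite -walkE mapK // all_map; congr (if _ && _ then S v (flatten _) else 0).
  by elim: s => //= a s <-; case: (h _).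
- move=> v s; apply: ext => w t; rewrite phiE !coef_pth -[walk v (map rho s)]walkE mapK //.
  congr ((nat_of_bool (_ && _))%:R); apply/eqP/eqP => [[-> ->] //|[-> e]].
  by rewrite (inj_map (can_inj rhoK) e).
- by move=> c; apply: cpalgP => v s; rewrite renE !coef_vertex; case: s.
exists (fun y : cpalg K Q' => series (fun v s => y v (map rho s)) : cpalg K Q) => x;
  apply: cpalgP => v s.
  by rewrite {1}/coef /=; case: ifPn => [//|h]; rewrite coef_off.
rewrite renE {1}/coef /= -map_comp (eq_map (g := id)) ?map_id // walkE.
by case: ifPn => // h; rewrite coef_off.
Qed.

(** Words in the letters [j a] are decoded letter by letter, so rotating them
    commutes with decoding. *)
Lemma cyc_reindex (K : fieldType) (V : finType) (Q Q' : quiver V) (j : Q -> Q')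
    (h : Q' -> option (seq Q)) :
  (forall a, src (j a) = src a) -> (forall a, tgt (j a) = tgt a) ->
  (forall a, h (j a) = Some [:: a]) ->
  (forall b s, h b = Some s -> exists2 a, b = j a & s = [:: a]) ->
  (forall v s, reindex h (pth K v s) = pth K v (map j s)) /\
  forall S W : cpalg K Q, cyc_equiv S W -> cyc_equiv (reindex h S) (reindex h W).
Proof.
move=> j_src j_tgt hj jh.
have h_code : path_code h.
  split=> [b s /jh[a -> ->]|b b' s s' r r' /jh[a -> ->] /jh[a' -> ->] [->]//].
  by rewrite /= j_src eqxx j_tgt.
have walkE v (s : seq Q) : walk v (map j s) = walk v s.
  by elim: s v => //= a s IHs v; rewrite IHs j_src j_tgt.
have wendE v (s : seq Q) : wend v (map j s) = wend v s.
  by rewrite /wend -map_comp; congr last; apply: eq_map => a; rewrite /= j_tgt.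
have pthE v s : reindex h (pth K v s) = pth K v (map j s).
  case: (boolP (walk v s)) => hw; last by rewrite !pth_off ?reindex0 // walkE.
  rewrite -(@reindex_pth _ _ _ _ _ h_code v (map j s)); last first.
    by rewrite all_map; apply/allP => a _; rewrite /= hj.
  by congr (reindex h (pth K v _)); elim: s {hw} => //= a s {1}->; rewrite hj.
split=> // S W hSW d; have [c hc hd] := hSW d; exists (reindex h c).
  elim: {hd}hc => [|k v s a y hc _ IH]; first by rewrite reindex0; apply: cyc_span0.
  rewrite reindexD reindexZ reindexD -scaleN1r reindexZ scaleN1r !pthE map_rcons.
  rewrite map_cons -j_src; apply: cyc_spanD IH; case/and3P: hc => _ hw he.
  by rewrite /is_cycle -map_rcons walkE wendE hw he; case: (s).
rewrite -!scaleN1r -!reindexZ -!reindexD !scaleN1r => v t ht; rewrite coef_reindex.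
case: ifP => // /andP[_ ha]; apply: hd; suff -> : size (flatten (pmap h t)) = size t by [].
elim: t ha {ht} => //= b t IHt; case hb: (h b) => [s|//] /= /IHt e.
by rewrite size_cat e; have [a _ ->] := jh _ _ hb.
Qed.

(** * Corners around the puncture *)

Section Triangulation.
Context {g : nat} {I : finType}.
Variable tau : triangulation g I.
Implicit Types (s t : side I) (k : I) (c : bool).

Local Notation turn := (@arrow_g g I tau).

Lemma oppK : involutive (@opp I).
Proof. by case=> i b; rewrite /opp /= negbK. Qed.

Lemma cw_inj : injective (cw tau).
Proof. by move=> s t e; rewrite -(cw3 tau s) e cw3. Qed.

Lemma turn_inj : injective turn.
Proof. exact: inj_comp (can_inj oppK) cw_inj. Qed.

(** The turns have as many orbits as there are punctures. *)
Lemma turn_connected s t : fconnect turn s t.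
Proof.
have sym : connect_sym (frel turn) by apply/fconnect_sym/turn_inj.
have [r hr] := mem_card1 (one_puncture tau).
have root1 u : froot turn u = r.
  by apply/eqP; have := hr (froot turn u); rewrite !inE (roots_root sym).
by rewrite -(root_connect sym) !root1.
Qed.

Lemma order_turn s : order turn s = #|side I|.
Proof. by apply: eq_card => t; rewrite !inE turn_connected. Qed.

Lemma turn_period s : iter #|side I| turn s = s.
Proof. by rewrite -(order_turn s) iter_order //; apply: turn_inj. Qed.

(** ** The two triangles at an arc *)

(** The two triangles at [k] have the sides [(k, c)], [side1 k c], [side2 k c]
    in clockwise order. *)
Definition side1 k c : side I := cw tau (k, c).
Definition side2 k c : side I := cw tau (side1 k c).

Lemma cw_side2 k c : cw tau (side2 k c) = (k, c).
Proof. exact: cw3. Qed.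

Lemma side1_off k c : (side1 k c).1 != k.
Proof. exact: (cw_arc tau (k, c)). Qed.

Lemma side2_off k c : (side2 k c).1 != k.
Proof. by have := cw_arc tau (side2 k c); rewrite cw_side2 eq_sym. Qed.

Lemma side1_inj k : injective (side1 k).
Proof. by move=> c d /cw_inj[]. Qed.

Lemma side2_inj k : injective (side2 k).
Proof. by move=> c d /cw_inj/side1_inj. Qed.

Lemma side12 k c d : side1 k c != side2 k d.
Proof. by apply/eqP=> /cw_inj e; have := side1_off k d; rewrite -e eqxx. Qed.

Definition near k s : bool :=
  [|| s.1 == k, (cw tau s).1 == k | (cw tau (cw tau s)).1 == k].

Lemma near_cw k s : near k (cw tau s) = near k s.
Proof. by rewrite /near cw3 orbA orbC. Qed.

Lemma near_side1 k c : near k (side1 k c).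
Proof. by rewrite near_cw /near eqxx. Qed.

Lemma near_side2 k c : near k (side2 k c).
Proof. by rewrite near_cw near_side1. Qed.

Variant near_spec k s : bool -> Prop :=
  | NearK c of s = (k, c) : near_spec k s true
  | NearSide1 c of s = side1 k c : near_spec k s true
  | NearSide2 c of s = side2 k c : near_spec k s true
  | NotNear of s.1 != k & (cw tau s).1 != k & s != side1 k false
      & s != side1 k true : near_spec k s false.

Lemma nearP k s : near_spec k s (near k s).
Proof.
rewrite /near; case: (s.1 =P k) => [e|/eqP nk] /=.
  by apply: (NearK (c := s.2)); rewrite -e; case: (s).
case: ((cw tau s).1 =P k) => [e|/eqP n2] /=.
  apply: (NearSide2 (c := (cw tau s).2)); apply: cw_inj; rewrite cw_side2 -e.
  by case: (cw tau s).
case: ((cw tau (cw tau s)).1 =P k) => [e|n1] /=.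
  apply: (NearSide1 (c := (cw tau (cw tau s)).2)); apply: cw_inj; apply: cw_inj.
  by rewrite -/(side2 _ _) cw_side2 -e; case: (cw tau (cw tau s)).
by constructor=> //; apply/eqP=> e; case: n1; rewrite e -/(side2 _ _) cw_side2.
Qed.

Lemma cw_eq_k k s : (cw tau s).1 = k -> exists c, s = side2 k c.
Proof.
move=> e; exists (cw tau s).2; apply: cw_inj; rewrite cw_side2 -e.
by case: (cw tau s).
Qed.

(** A 2-cycle would be a puncture with only two corners, but all corners, among
    them the one at [side1 k c], lie at the same puncture. *)
Lemma surface_no_2cycle k : no_2cycle_at (surface_quiver tau) k.
Proof.
move=> a b; rewrite /= => ea eb.
have {ea} [c ->] : exists c, a = (k, c) by exists a.2; rewrite -ea; case: (a).
have {eb} [d ->] := cw_eq_k eb.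
rewrite -/(side1 k c); apply/eqP=> e.
have [ecd|ncd] := eqVneq c d.
  by have := cw_arc tau (side1 k c); rewrite -/(side2 _ _) ecd -{2}ecd e eqxx.
have e1 : turn (k, c) = side2 k d.
  have : side1 k c = side2 k d \/ side1 k c = opp (side2 k d).
    case: (side1 k c) (side2 k d) e => [i b1] [j b2] /= ->.
    by rewrite /opp /=; case: b1 b2 => [] []; [left|right|right|left].
  by case=> [/eqP|e2]; [rewrite (negbTE (side12 _ _ _)) | rewrite /arrow_g -/(side1 k c) e2 oppK].
have e2 : turn (side2 k d) = (k, c).
  by rewrite /arrow_g cw_side2 /opp /=; congr (_, _); case: c d ncd {e1 e} => [] [].
have all2 i : iter i turn (k, c) \in [:: (k, c); side2 k d].
  elim: i => [|i IHi]; first by rewrite mem_head.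
  by rewrite iterS; move: IHi; rewrite !inE => /orP[] /eqP->; rewrite (e1, e2) eqxx ?orbT.
have := all2 (findex turn (k, c) (side1 k c)).
rewrite iter_findex ?turn_connected // !inE (negbTE (side12 _ _ _)) orbF => /eqP e3.
by have := side1_off k c; rewrite e3 eqxx.
Qed.

(** ** Walking around the puncture with the arc [k] removed *)

Definition turn_without k s : side I := opp (cw_without tau k s).

(** The corners of the triangulation that make up the corner at [s] of the
    region containing [s] when [k] is removed. *)
Definition corners k s : seq (side I) :=
  if (cw tau s).1 == k then [:: s; turn s] else [:: s].

Lemma turn_without_off k s : (turn_without k s).1 != k.
Proof.
rewrite /turn_without /cw_without /=; case: ifP => [/eqP e|->//].
by have := cw_arc tau (opp (cw tau s)); rewrite /= e.
Qed.

Lemma iter_turn_without_off k s m : s.1 != k -> (iter m (turn_without k) s).1 != k.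
Proof. by case: m => //= m _; apply: turn_without_off. Qed.

Lemma traject_turn_without_off k s m t :
  s.1 != k -> t \in traject (turn_without k) s m -> t.1 != k.
Proof. by move=> hs /trajectP[i _ ->]; apply: iter_turn_without_off. Qed.

Definition corners_word k s m : seq (side I) :=
  flatten (map (corners k) (traject (turn_without k) s m)).

Lemma corners_wordE k s m :
  corners_word k s m = traject turn s (size (corners_word k s m)) /\
  iter (size (corners_word k s m)) turn s = iter m (turn_without k) s.
Proof.
elim: m s => [//|m IHm] s; have [IH1 IH2] := IHm (turn_without k s).
have -> : corners_word k s m.+1 = corners k s ++ corners_word k (turn_without k s) m by [].
rewrite size_cat (iterSr m (turn_without k)) -IH2.
move: (size _) IH1 {IH2} => N; rewrite /turn_without /cw_without /corners.
by case: ifP => _ ->; rewrite -?iterSr.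
Qed.

Lemma corners_wordS k s m : corners_word k s m.+1 =
  corners_word k s m ++ corners k (iter m (turn_without k) s).
Proof. by rewrite /corners_word trajectSr map_rcons -cats1 flatten_cat /= cats0. Qed.

(** A block of corners begins at every corner that does not start at [k], so the
    blocks before it fill the walk up to there. *)
Lemma corners_word_reach k s j : s.1 != k -> (iter j turn s).1 != k ->
  exists m, size (corners_word k s m) = j.
Proof.
move=> hs; elim/ltn_ind: j => -[|j] IHj hj; first by exists 0%N.
have hit i : (i <= j)%N -> (iter i turn s).1 != k ->
    exists m, size (corners_word k s m.+1)
      = (i + size (corners k (iter i turn s)))%N.
  move=> hi hk; have [m em] := IHj i hi hk; exists m.
  by rewrite corners_wordS size_cat em -(corners_wordE k s m).2 em.
have [hk|] := boolP ((iter j turn s).1 != k).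
  have [m em] := hit j (leqnn j) hk; exists m.+1; rewrite em /corners.
  by move: hj; rewrite iterS /= => /negbTE ->; rewrite addn1.
case: j hj IHj hit => [|j] hj IHj hit; first by rewrite /= hs.
rewrite negbK iterS => /eqP e.
have hk : (iter j turn s).1 != k.
  by have := cw_arc tau (iter j turn s); rewrite [X in X != _]e eq_sym.
have [m em] := hit j (leqnSn j) hk; exists m.+1; rewrite em /corners.
by move: e; rewrite /arrow_g /= => ->; rewrite eqxx addn2.
Qed.

Lemma filter_corners k (L : seq (side I)) : (forall s, s \in L -> s.1 != k) ->
  [seq t <- flatten (map (corners k) L) | t.1 != k] = L.
Proof.
elim: L => //= s L IHL hL; rewrite filter_cat IHL => [|t ht]; last first.
  by apply: hL; rewrite inE ht orbT.
by rewrite /corners; case: ifP => [/eqP e|_] /=; rewrite hL ?mem_head //= e eqxx.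
Qed.

(** Since there is one puncture, the walk with [k] removed meets every corner
    that does not start at [k] exactly once. *)
Lemma puncture_walk k s : s.1 != k ->
  let L := traject (turn_without k) s #|[pred t : side I | t.1 != k]| in
  [/\ traject turn s #|side I| = flatten (map (corners k) L),
      uniq L & L =i [pred t | t.1 != k]].
Proof.
move=> hs; have [|M eM] := @corners_word_reach k s #|side I| hs.
  by rewrite turn_period.
have [] := corners_wordE k s M; rewrite eM => hw _.
set L := traject (turn_without k) s M.
have hL t : t \in L -> t.1 != k by apply: traject_turn_without_off.
have LE : L = [seq t <- traject turn s #|side I| | t.1 != k].
  by rewrite -hw filter_corners.
have uL : uniq L by rewrite LE filter_uniq // -(order_turn s) orbit_uniq.
have mL : L =i [pred t | t.1 != k].
  move=> t; rewrite LE mem_filter inE; case: (t.1 != k) => //=.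
  by rewrite -(order_turn s) -fconnect_orbit turn_connected.
have -> : #|[pred t : side I | t.1 != k]| = M.
  by rewrite -(eq_card mL) (card_uniqP uL) size_traject.
by split.
Qed.

End Triangulation.

(** * Flips *)

Section Flip.
Context {g : nat} {I : finType} {tau sigma : triangulation g I} {k : I}.
Hypothesis hflip : flip k tau sigma.
Implicit Types (s : side I) (c d : bool).

Lemma turn_without_flip s m : s.1 != k ->
  traject (turn_without sigma k) s m = traject (turn_without tau k) s m.
Proof.
elim: m s => //= m IHm s hs.
have e : turn_without sigma k s = turn_without tau k s.
  by rewrite /turn_without hflip.1.
by rewrite e IHm // turn_without_off.
Qed.

Lemma cw_without_side1 (rho : triangulation g I) c :
  cw_without rho k (side1 rho k c) = side2 rho k c.
Proof. by rewrite /cw_without -/(side2 _ _ _) (negbTE (side2_off _ _ _)). Qed.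

Lemma cw_without_side2 (rho : triangulation g I) c :
  cw_without rho k (side2 rho k c) = side1 rho k (~~ c).
Proof. by rewrite /cw_without cw_side2 /= eqxx. Qed.

(** The new arc joins the other two corners of the quadrilateral, so the new
    triangles pair the second side of one old triangle with the first side of
    the other one. *)
Lemma flip_quadrilateral : exists e : bool,
  [/\ forall c, side1 sigma k (e (+) c) = side2 tau k (~~ c),
      forall c, side2 sigma k (e (+) c) = side1 tau k c
    & forall s, ~~ near tau k s -> cw sigma s = cw tau s].
Proof.
have w1 c : cw_without tau k (side1 sigma k c) = side2 sigma k c.
  by rewrite hflip.1 ?side1_off // cw_without_side1.
have w2 c : cw_without tau k (side2 sigma k c) = side1 sigma k (~~ c).
  by rewrite hflip.1 ?side2_off // cw_without_side2.
have away s : ~~ near tau k s -> cw_without tau k s = cw tau s.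
  by case: nearP => // h1 h2 _ _ _; rewrite /cw_without (negbTE h2).
have out s : ~~ near tau k s -> (cw sigma s).1 != k -> cw sigma s = cw tau s.
  move=> hn hk; rewrite -(away s hn) hflip.1 ?/cw_without ?(negbTE hk) //.
  by case: nearP hn.
(* Otherwise the walk around the quadrilateral of [sigma], which has period 4,
   would be a walk around a triangle of [tau], which has period 3. *)
have : near tau k (side1 sigma k false).
  apply: contraT => hn; set s := side1 _ _ _ in hn.
  have := w1 false; rewrite -/s away // => e2.
  have := w2 false; rewrite -e2 away ?near_cw // => e3.
  have := w1 true; rewrite -e3 away ?near_cw // cw3 => e4.
  have := w2 true; rewrite -e4 away // => e5.
  by have := cw_arc tau s; rewrite e5 /= -/s eqxx.
case: nearP => // c e _; first by have := side1_off sigma k false; rewrite e eqxx.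
  (* The first sides agree: the triangles at [k] are the old ones. *)
  case: hflip.2; exists c.
  have e1 d : side1 sigma k d = side1 tau k (c (+) d) /\
      side2 sigma k d = side2 tau k (c (+) d).
    have e2 : side2 sigma k false = side2 tau k c by rewrite -w1 e cw_without_side1.
    have e3 : side1 sigma k true = side1 tau k (~~ c).
      by rewrite -[true]/(~~ false) -w2 e2 cw_without_side2.
    case: d; rewrite ?addbF ?addbT; split=> //.
    by rewrite -w1 e3 cw_without_side1.
  move=> s; case: (boolP (near tau k s)).
    case: nearP => // d -> _.
    - rewrite /relabel /= eqxx -/(side1 _ _ _) (e1 _).1 addbA addbb addFb.
      by rewrite -/(side1 _ _ _) (negbTE (side1_off _ _ _)).
    - rewrite {1}/relabel (negbTE (side1_off _ _ _)) /relabel -/(side2 _ _ _).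
      rewrite (negbTE (side2_off _ _ _)) -{1}[d](addKb c) -(e1 _).1.
      by rewrite -/(side2 _ _ _) (e1 _).2 addKb.
    - rewrite {1}/relabel (negbTE (side2_off _ _ _)) cw_side2 /relabel /= eqxx.
      by rewrite -{1}[d](addKb c) -(e1 _).2 cw_side2.
  move=> hn; have hk : s.1 != k by case: nearP hn.
  have hk2 : (cw tau s).1 != k by case: nearP hn.
  rewrite /relabel (negbTE hk) (negbTE hk2) out //.
  apply/eqP=> /cw_eq_k[d es]; move: hn.
  by rewrite es (e1 d).2 near_side2.
(* The first sides of [sigma] are the second sides of [tau]. *)
have e2 : side2 sigma k false = side1 tau k (~~ c).
  by rewrite -w1 e cw_without_side2.
have e3 : side1 sigma k true = side2 tau k (~~ c).
  by rewrite -[true]/(~~ false) -w2 e2 cw_without_side1.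
have e4 : side2 sigma k true = side1 tau k c.
  by rewrite -w1 e3 cw_without_side2 negbK.
have e1 d : side1 sigma k d = side2 tau k (c (+) d) /\
    side2 sigma k d = side1 tau k (~~ (c (+) d)).
  by case: d; rewrite ?addbF ?addbT ?negbK.
exists (~~ c); split=> [d|d|s hn].
- by rewrite (e1 _).1 addNb addbN addKb.
- by rewrite (e1 _).2 addNb addbN addKb negbK.
rewrite out //; apply/eqP=> /cw_eq_k[d es]; move: hn.
by rewrite es (e1 d).2 near_side1.
Qed.

End Flip.

(** * Trivial quivers with potential *)

Section TwoCycles.
Context {K : fieldType} {V J : finType}.
Variables v w : J -> V.

Definition two_cycles : quiver V := @Quiver V (J * bool)%type
  (fun a => if a.2 then w a.1 else v a.1) (fun a => if a.2 then v a.1 else w a.1).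

Definition two_cycle_word (j : J) : seq two_cycles := [:: (j, false); (j, true)].

Definition two_cycles_pot : cpalg K two_cycles := \sum_j pth K (v j) (two_cycle_word j).

Lemma two_cycles_potP : is_potential two_cycles_pot.
Proof. by apply: pot_sum => j _; apply: pot_pth; rewrite /is_cycle /= !eqxx. Qed.

Definition two_cycles_qp : QP K V := MkQP two_cycles_potP.

Definition partner (a : two_cycles) : two_cycles := (a.1, ~~ a.2).

(** The rotations of [[:: a; b]] are [[:: a; b]] and [[:: b; a]], and only one of
    them is written with the arrow [(j, false)] first. *)
Lemma cyc_deriv_two_cycles a : cyc_deriv a two_cycles_pot = arr (partner a).
Proof.
have potE u (b c : two_cycles) : u = src b ->
    two_cycles_pot u [:: b; c] = ((c == partner b) && ~~ b.2)%:R.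
  move=> ->; rewrite cp_coef_sum (bigD1 b.1) //= big1 ?addr0 => [|j nj].
    rewrite coef_pth /= !eqxx /= -pair_eqE /= !eqseq_cons andbT.
    by case: b c => [b []] [c []]; rewrite /partner -!pair_eqE /= ?andbF ?andbT ?eqxx.
  rewrite coef_pth -pair_eqE /= !eqseq_cons.
  by case: b nj => b [] nj; rewrite -!pair_eqE /= [b == j]eq_sym ?(negbTE nj) ?andbF.
apply: cpalgP => u s; rewrite coef_pth /= eqxx /=.
have -> : cyc_deriv a two_cycles_pot u s = if walk u s && (u == tgt a) then
    \sum_(i < (size s).+1) let r := rot i (a :: s) in two_cycles_pot (src (head a r)) r
    else 0.
  by rewrite {1}/coef /=; case: (walk u s).
have pot2 : in_mpow 2 two_cycles_pot /\
    forall u s, (2 < size s)%N -> two_cycles_pot u s = 0.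
  split=> u' s' hs; rewrite cp_coef_sum big1 // => j _; rewrite coef_pth -pair_eqE /=;
    by case: (s' =P _) hs => [->|] //; rewrite !andbF.
case: s => [|b [|c s]].
- rewrite big_ord1 /= pot2.1 // if_same; by rewrite -pair_eqE /= andbF.
- rewrite big_ord_recr big_ord1 /= !potE //.
  rewrite -!pair_eqE /= eqseq_cons andbT.
  case: a b => [a ba] [b bb]; rewrite /partner -!pair_eqE /=.
  rewrite [b == a]eq_sym; case: (a =P b) => [->|]; last first.
    by rewrite ?andbF /= !addr0 if_same.
  case: ba; case: bb; rewrite /= ?andbF ?andbT ?addr0 ?add0r ?if_same //=;
    rewrite [u == _]eq_sym; case: eqP => //= ->; by rewrite eqxx.
- rewrite big1 ?if_same => [|i _]; last by apply: pot2.2; rewrite size_rot.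
  by rewrite -pair_eqE /= eqseq_cons !andbF.
Qed.

Lemma trivial_two_cycles : trivial_qp two_cycles_qp.
Proof.
split=> [u s hs|x].
  rewrite cp_coef_sum big1 // => j _; rewrite coef_pth -pair_eqE /=.
  by case: (s =P _) hs => [->|] //; rewrite !andbF.
have partnerK : involutive partner by case=> j b; rewrite /partner /= negbK.
have E (c : two_cycles -> K) : \sum_a c a *: cyc_deriv a two_cycles_pot
    = \sum_a c (partner a) *: arr a.
  rewrite (reindex_inj (inv_inj partnerK)) /=; apply: eq_bigr => a _.
  by rewrite cyc_deriv_two_cycles partnerK.
split=> [hx|[c ->]]; last first.
  rewrite E => u s hs; rewrite cp_coef_sum big1 // => a _; rewrite cp_coefZ coef_pth.
  rewrite -pair_eqE /=; case: (s =P _) hs => [->|] //; by rewrite !andbF mulr0.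
exists (fun a => x (src (partner a)) [:: partner a]); rewrite E.
apply: cpalgP => u s; rewrite cp_coef_sum.
have F a : (x (src (partner (partner a))) [:: partner (partner a)] *: arr a) u s
    = if (u, s) == (src a, [:: a]) then x u s else 0.
  rewrite cp_coefZ partnerK coef_pth /= eqxx /=.
  by case: eqP => [[-> ->]|_]; rewrite ?mulr1 ?mulr0.
rewrite (eq_bigr _ (fun a _ => F a)); case: s F => [|a [|b s]] F; first 1 last.
- rewrite (bigD1 a) //= big1 ?addr0 => [|b nb].
    rewrite -pair_eqE /= eqxx andbT; case: (u =P _) => // ne.
    by rewrite coef_off //= negb_and eq_sym; case: eqP ne.
  by rewrite -pair_eqE /= eqseq_cons [a == b]eq_sym (negbTE nb) andbF.
- by rewrite hx // big1 // => c _; rewrite if_same.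
- by rewrite hx // big1 // => c _; rewrite if_same.
Qed.

End TwoCycles.

(** * Normal forms of the potential of a triangulation *)

Section SurfacePotential.
Context {K : fieldType} {g : nat} {I : finType}.
Variable tau : triangulation g I.
Implicit Types (s t : side I) (k : I) (c : bool).

Local Notation turn := (@arrow_g g I tau).

Definition triangle_word s : seq (surface_quiver tau) :=
  [:: s; cw tau s; cw tau (cw tau s)].
Definition triangle_cycle s : cpalg K (surface_quiver tau) :=
  pth K s.1 (triangle_word s).

Lemma triangle_is_cycle s : is_cycle s.1 (triangle_word s).
Proof. by rewrite /is_cycle /= /wend /= cw3 !eqxx. Qed.

Lemma cyc_triangle s : cyc_equiv (triangle_cycle s) (triangle_cycle (cw tau s)).
Proof.
have := @cyc_rot K _ (surface_quiver tau) s.1 [:: s] [:: cw tau s; cw tau (cw tau s)].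
rewrite /triangle_cycle /triangle_word cw3; apply; exact: triangle_is_cycle.
Qed.

Definition transversal (P X : pred (side I)) : Prop :=
  forall s, P s -> (X s + X (cw tau s) + X (cw tau (cw tau s)) = 1)%N.

Let root s := froot (@arrow_f g I tau) s.

Lemma root_cw s : root (cw tau s) = root s.
Proof.
have sym : connect_sym (frel (@arrow_f g I tau)) by apply/fconnect_sym/cw_inj.
by apply/esym/eqP; rewrite (root_connect sym) fconnect1.
Qed.

Lemma root_eqP s t : reflect (t \in [:: s; cw tau s; cw tau (cw tau s)]) (root t == root s).
Proof.
have sym : connect_sym (frel (@arrow_f g I tau)) by apply/fconnect_sym/cw_inj.
apply: (iffP idP) => [|]; last first.
  by rewrite !inE => /or3P[] /eqP->; rewrite ?root_cw.
rewrite eq_sym (root_connect sym) => /iter_findex <-; move: (findex _ _ _) => i.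
elim: i => [|i]; first by rewrite mem_head.
by rewrite iterS !inE => /or3P[] /eqP->; rewrite /arrow_f ?cw3 ?eqxx ?orbT.
Qed.

Lemma cw_neq s : (cw tau s != s) && (cw tau (cw tau s) != s).
Proof.
have h t : cw tau t != t by apply: contraNneq (cw_arc tau t) => ->.
by rewrite h /=; apply/eqP=> e; have := h (cw tau (cw tau s)); rewrite cw3 e eqxx.
Qed.

Lemma froots_transversal P : transversal P (froots (@arrow_f g I tau)).
Proof.
move=> s _; rewrite /roots -!/(root _) !root_cw.
have /root_eqP : root (root s) == root s.
  rewrite /root root_root //; exact/fconnect_sym/cw_inj.
have /andP[n1 n2] := cw_neq s; have /andP[n3 _] := cw_neq (cw tau s).
rewrite !inE => /or3P[] /eqP->; rewrite eqxx.
- by rewrite [s == cw _ _]eq_sym [s == cw _ (cw _ _)]eq_sym (negbTE n1) (negbTE n2).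
- by rewrite [cw _ _ == cw _ (cw _ _)]eq_sym (negbTE n1) (negbTE n3).
- by rewrite (negbTE n2) (negbTE n3).
Qed.

(** Each triangle contributes its 3-cycle once, from whichever side it is
    read. *)
Lemma cyc_surface_T X : transversal predT X ->
  cyc_equiv (surface_T tau) (\sum_(s | X s) triangle_cycle s).
Proof.
move=> hX; rewrite (partition_big root (froots (@arrow_f g I tau))) => [|s _]; last first.
  rewrite /roots /root root_root //; exact/fconnect_sym/cw_inj.
apply: cyc_sum => r; rewrite /roots -/(root r) => /eqP er.
rewrite -[pth _ _ _]/(triangle_cycle r).
have inner t : t \in [:: r; cw tau r; cw tau (cw tau r)] -> X t ->
    \sum_(s | X s && (root s == r)) triangle_cycle s = triangle_cycle t.
  move=> ht Xt; apply: big_pred1 => s /=; rewrite -{1}er; apply/andP/eqP=> [|->].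
    case=> Xs /root_eqP hs; move: ht hs Xt Xs (hX r isT); rewrite !inE.
    by do 2![case/or3P=> /eqP->] => // -> ->; case: (X _).
  by split=> //; apply/root_eqP.
have := hX r isT; case X0: (X r); case X1: (X (cw tau r));
  case X2: (X (cw tau (cw tau r))) => // _.
- by rewrite (inner r) ?mem_head //; apply: cyc_refl.
- by rewrite (inner (cw tau r)) ?inE ?eqxx ?orbT //; apply: cyc_triangle.
- rewrite (inner (cw tau (cw tau r))) ?inE ?eqxx ?orbT //.
  exact: cyc_trans (cyc_triangle _) (cyc_triangle _).
Qed.

(** The triangles at [k] are read from the sides [side2 tau k c], so that their
    3-cycles do not start at [k]; the choice [R] of a side in each of the others is
    free, so that two triangulations can use the same one. *)
Lemma cyc_surface_T_near k R : transversal [pred s | ~~ near tau k s] R ->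
  cyc_equiv (surface_T tau) (\sum_c triangle_cycle (side2 tau k c)
    + \sum_(s | ~~ near tau k s && R s) triangle_cycle s).
Proof.
move=> hR; pose X s := if near tau k s then (cw tau s).1 == k else R s.
have hX : transversal predT X.
  move=> s _; rewrite /X !near_cw; case: ifP => [|/negbT/hR//].
  rewrite cw3; case: nearP => // c ->.
  - by rewrite /= eqxx -/(side1 _ _ _) -/(side2 _ _ _)
      (negbTE (side1_off _ _ _)) (negbTE (side2_off _ _ _)).
  - by rewrite -/(side2 _ _ _) cw_side2 /= eqxx
      (negbTE (side1_off _ _ _)) (negbTE (side2_off _ _ _)).
  - by rewrite cw_side2 /= eqxx -/(side1 _ _ _)
      (negbTE (side1_off _ _ _)) (negbTE (side2_off _ _ _)).
apply: cyc_trans (cyc_surface_T hX) _; rewrite (bigID (near tau k)) /=.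
have -> : \sum_(s | X s && near tau k s) triangle_cycle s
    = \sum_c triangle_cycle (side2 tau k c).
  rewrite (reindex_onto (side2 tau k) (fun s => (cw tau s).2)) /= => [|s].
    by apply: eq_bigl => c; rewrite /X near_side2 !cw_side2 /= !eqxx.
  rewrite /X andbC; case: ifP => //= _ /eqP/cw_eq_k[c ->]; by rewrite cw_side2.
apply: cycD; first exact: cyc_refl.
rewrite (eq_bigl (fun s => ~~ near tau k s && R s)); first exact: cyc_refl.
by move=> s; rewrite /X andbC; case: near.
Qed.

Lemma walk_traject s m : walk (Q := surface_quiver tau) s.1 (traject turn s m).
Proof. by elim: m s => //= m IHm s; rewrite eqxx; apply: (IHm (turn s)). Qed.

Lemma wend_traject s m :
  wend (Q := surface_quiver tau) s.1 (traject turn s m) = (iter m turn s).1.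
Proof. by elim: m s => // m IHm s; rewrite iterSr -IHm. Qed.

Lemma surface_G_is_cycle s :
  is_cycle (Q := surface_quiver tau) s.1 (traject turn s #|side I|).
Proof.
rewrite /is_cycle walk_traject wend_traject turn_period eqxx !andbT.
by rewrite -size_eq0 size_traject -lt0n; apply/card_gt0P; exists s.
Qed.

(** Moving the starting point of the cycle around the puncture rotates it. *)
Lemma cyc_surface_G (a b : surface_quiver tau) n : (0 < n)%N ->
  cyc_equiv (@surface_G K g I tau a ^+ n) (@surface_G K g I tau b ^+ n).
Proof.
move=> hn; set N := #|side I|.
have eb := iter_findex (turn_connected tau a b); set i := findex _ _ _ in eb.
have hi : (i <= N)%N.
  by rewrite /N -(order_turn tau a) ltnW // findex_max // turn_connected.
have ea : iter (N - i) turn b = a by rewrite -eb -iterD subnK // turn_period.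
pose x := pth K b.1 (traject turn b (N - i) : seq (surface_quiver tau)).
pose y := pth K a.1 (traject turn a i : seq (surface_quiver tau)).
have wy : wend (Q := surface_quiver tau) a.1 (traject turn a i) = b.1.
  by rewrite wend_traject eb.
have wx : wend (Q := surface_quiver tau) b.1 (traject turn b (N - i)) = a.1.
  by rewrite wend_traject ea.
have Ga : @surface_G K g I tau a = x * y.
  rewrite /x /y pthM wy eqxx /surface_G; congr (pth K _ _).
  by rewrite -[#|_|](subnKC hi) trajectD eb.
have Gb : @surface_G K g I tau b = y * x.
  rewrite /x /y pthM wx eqxx /surface_G; congr (pth K _ _).
  by rewrite -[#|_|](subnK hi) trajectD ea.
rewrite Ga Gb; apply: (cyc_mulC_exp (v := b.1) (w := a.1)) => //.
  by rewrite -{1}wx; apply: from_to_pth.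
by rewrite -{1}wy; apply: from_to_pth.
Qed.

End SurfacePotential.

Lemma pth_exp (K : fieldType) (V : finType) (Q : quiver V) v (s : seq Q) n :
  (0 < n)%N -> wend v s = v -> pth K v s ^+ n = pth K v (flatten (nseq n s)).
Proof.
case: n => // n _ e; elim: n => [|n IHn]; first by rewrite expr1 /= cats0.
by rewrite exprSr IHn pthM e eqxx.
Qed.

Section PunctureWord.
Context {K : fieldType} {g : nat} {I : finType}.
Variable (tau : triangulation g I).

(** The starting points other than [k] of the corners met in [n] turns around
    the puncture, from the corner [s] on. *)
Definition puncture_word k s n : seq (side I) :=
  flatten (nseq n (traject (turn_without tau k) s #|[pred t : side I | t.1 != k]|)).

Lemma puncture_word_corners k s n : s.1 != k ->
  flatten (map (corners tau k) (puncture_word k s n))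
  = flatten (nseq n (traject (@arrow_g g I tau) s #|side I|)).
Proof.
move=> hs; have [-> _ _] := puncture_walk tau hs; rewrite /puncture_word.
by elim: n => //= n <-; rewrite map_cat flatten_cat.
Qed.

Lemma puncture_word_is_cycle k s n : (0 < n)%N -> s.1 != k ->
  is_cycle (Q := surface_quiver tau) s.1
    (flatten (map (corners tau k) (puncture_word k s n))).
Proof.
move=> hn hs; rewrite puncture_word_corners //.
have /and3P[ne hw /eqP he] := surface_G_is_cycle tau s.
elim: n hn => // -[|n] IHn _; first by rewrite /= cats0 surface_G_is_cycle.
have /and3P[_ hw' he'] := IHn isT.
rewrite /is_cycle walk_cat wend_cat he hw -/(flatten (nseq _ _)) hw' he' !andbT.
by move: ne; rewrite /=; case: (traject _ _ _).
Qed.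

Lemma surface_G_corners k s n : (0 < n)%N -> s.1 != k ->
  @surface_G K g I tau (s : surface_quiver tau) ^+ n
  = pth K s.1 (flatten (map (corners tau k) (puncture_word k s n)) :
                 seq (surface_quiver tau)).
Proof.
move=> hn hs; rewrite /surface_G pth_exp ?puncture_word_corners //.
by rewrite wend_traject turn_period.
Qed.

Lemma surface_S_normal k R s (a : surface_quiver tau) x n : (0 < n)%N ->
  transversal tau [pred s | ~~ near tau k s] R -> s.1 != k ->
  cyc_equiv (surface_S x n a)
    (\sum_c triangle_cycle tau (side2 tau k c)
     + \sum_(s | ~~ near tau k s && R s) triangle_cycle tau s
     + x *: pth K s.1 (flatten (map (corners tau k) (puncture_word k s n)) :
                         seq (surface_quiver tau))).
Proof.
move=> hn hR hs; apply: cycD; first exact: cyc_surface_T_near.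
by rewrite -surface_G_corners //; apply/cycZ/cyc_surface_G.
Qed.

End PunctureWord.

(** * Potentials on quivers without loops and 2-cycles *)

Section ShortCycles.
Context {K : fieldType} {V : finType} {Q : quiver V}.

Lemma potential_in_m2 (S : cpalg K Q) : loop_free Q -> is_potential S -> in_mpow 2 S.
Proof.
move=> hQ hS v [|a [|//]] _; apply: hS => //; rewrite /is_cycle /= /wend /= andbT.
by apply/andP=> -[/eqP<- /eqP e]; have := hQ a; rewrite e eqxx.
Qed.

Lemma potential_in_m3 (S : cpalg K Q) : loop_free Q ->
  (forall v, no_2cycle_at Q v) -> is_potential S -> in_mpow 3 S.
Proof.
move=> hQ h2 hS v s hs; case: (ltnP (size s) 2) => h; first exact: potential_in_m2.
case: s hs h => [|a [|b [|//]]] // _ _; apply: hS; rewrite /is_cycle /= /wend /= andbT.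
by apply/andP=> -[/andP[/eqP ea /eqP e] /eqP eb]; have := h2 v a b ea eb; rewrite e eqxx.
Qed.

Lemma premut_loop_free k : loop_free Q -> no_2cycle_at Q k ->
  loop_free (premut_quiver Q k).
Proof.
move=> hQ h2 [[[a /= ha]|[b c]]|[b|c]] /=; rewrite ?hQ //.
- by rewrite eq_sym h2 //; apply/eqP; [exact: (valP b) | exact: (valP c)].
- by rewrite eq_sym hQ.
- by rewrite eq_sym hQ.
Qed.

End ShortCycles.

(** * The premutation at the flipped arc *)

Section FlippedArc.
Context {K : fieldType} {g : nat} {I : finType} {tau sigma : triangulation g I} {k : I}.
Variable e : bool.
Hypothesis side1_sigma : forall c, side1 sigma k (e (+) c) = side2 tau k (~~ c).
Hypothesis side2_sigma : forall c, side2 sigma k (e (+) c) = side1 tau k c.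
Hypothesis cw_sigma : forall s, ~~ near tau k s -> cw sigma s = cw tau s.
Hypothesis without_sigma : forall s m, s.1 != k ->
  traject (turn_without sigma k) s m = traject (turn_without tau k) s m.
Implicit Types (s : side I) (c d : bool).

Local Notation p := (side1 tau k).
Local Notation q := (side2 tau k).
Local Notation Qtau := (surface_quiver tau).
Local Notation Qsigma := (surface_quiver sigma).

(** The side of the new arc in the triangle with the sides [p c] and
    [q (~~ c)]. *)
Definition new_side c : side I := (k, e (+) c).
Local Notation r := new_side.

Lemma cw_new c : cw sigma (r c) = q (~~ c).
Proof. exact: side1_sigma. Qed.
Lemma cw_sigma_q c : cw sigma (q c) = p (~~ c).
Proof. by rewrite -side2_sigma -[c in LHS]negbK -side1_sigma. Qed.
Lemma cw_sigma_p c : cw sigma (p c) = r c.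
Proof. by rewrite -side2_sigma cw_side2. Qed.

Lemma near_flip s : near sigma k s = near tau k s.
Proof.
case: (boolP (near tau k s)) => [|hn].
  by case: nearP => // c -> _; rewrite /near ?cw_sigma_q ?cw_sigma_p /= eqxx ?orbT.
case: nearP => // [c|c|c] es; move: hn; rewrite es.
- by rewrite /near eqxx.
- by rewrite -[c](addKb e) side1_sigma near_side2.
- by rewrite -[c](addKb e) side2_sigma near_side1.
Qed.

(** The arrows of the trivial part: [(c, false)] stands for the composite arrow
    from [q c] through [k] to [p c], and [(c, true)] for the arrow from [p c] to
    [q c] that closes it up to a 2-cycle. *)
Definition old_triangles : QP K I := two_cycles_qp (fun c => (q c).1) (fun c => (p c).1).
Local Notation Qsum := (quiver_sum Qsigma old_triangles).

Definition new_arrow s : Qsum := inl s.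
Definition old_comp c : Qsum := inr (c, false).
Definition old_base c : Qsum := inr (c, true).

(** The arrow of the sum that corresponds to the corner at the side [s] of the
    region of [s] when [k] is removed. *)
Definition corner_arrow s : Qsum :=
  if (cw tau (cw tau s)).1 == k then old_base (cw tau (cw tau s)).2
  else new_arrow s.

Lemma corner_arrow_p c : corner_arrow (p c) = old_base c.
Proof. by rewrite /corner_arrow -/(q c) cw_side2 eqxx. Qed.

Lemma corner_arrow_q c : corner_arrow (q c) = new_arrow (q c).
Proof. by rewrite /corner_arrow cw_side2 -/(p c) (negbTE (side1_off _ _ _)). Qed.

Lemma corner_arrow_away s : ~~ near tau k s -> corner_arrow s = new_arrow s.
Proof. by rewrite /corner_arrow /near !negb_or => /and3P[_ _ /negbTE->]. Qed.

Definition premut_to_sum (a : premut_quiver Qtau k) : Qsum :=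
  match a with
  | inl (inl s) => corner_arrow (val s)
  | inl (inr (b, c)) =>
      if (val b).2 == (cw tau (val c)).2 then old_comp (val b).2 else new_arrow (val c)
  | inr (inl b) => new_arrow (cw tau (val b))
  | inr (inr c) => new_arrow (r (~~ (cw tau (val c)).2))
  end.

Definition out_k c : arrow_out Qtau k := exist _ ((k, c) : Qtau) (eqxx k).
Definition in_k c : arrow_in Qtau k :=
  exist _ (q c : Qtau) (introT eqP (congr1 fst (cw_side2 tau k c))).

Lemma out_kE (b : arrow_out Qtau k) : b = out_k (val b).2.
Proof. by apply: val_inj; case: b => [[i c] /= /eqP->]. Qed.

Lemma in_kE (c : arrow_in Qtau k) : c = in_k (cw tau (val c)).2.
Proof.
apply: val_inj; case: c => [s /= /eqP hs]; have [d ->] := cw_eq_k hs.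
by rewrite cw_side2.
Qed.

Lemma off_p c : (src (p c : Qtau) != k) && (tgt (p c : Qtau) != k).
Proof. by rewrite /= -/(q c) side1_off side2_off. Qed.

Definition base_k c : arrow_off Qtau k := exist _ (p c : Qtau) (off_p c).

Lemma off_away s : ~~ near tau k s -> (src (s : Qtau) != k) && (tgt (s : Qtau) != k).
Proof. by case: nearP => //= -> ->. Qed.

Lemma not_near s : ~~ near tau k s ->
  [/\ (s.1 == k) = false, ((cw tau s).1 == k) = false
    & ((cw tau (cw tau s)).1 == k) = false].
Proof. by rewrite /near !negb_or => /and3P[/negbTE-> /negbTE-> /negbTE->]. Qed.

Variant premut_spec : premut_quiver Qtau k -> Type :=
  | PremutBase c : premut_spec (pm_off (base_k c))
  | PremutAway s (hs : ~~ near tau k s) :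
      premut_spec (pm_off (exist _ (s : Qtau) (off_away hs)))
  | PremutComp b c : premut_spec (pm_comp (out_k b) (in_k c))
  | PremutOut b : premut_spec (pm_star_out (out_k b))
  | PremutIn c : premut_spec (pm_star_in (in_k c)).

Lemma premutP a : premut_spec a.
Proof.
case: a => [[[s hs]|[b c]]|[b|c]]; last first.
- rewrite (in_kE c); exact: PremutIn.
- rewrite (out_kE b); exact: PremutOut.
- rewrite (in_kE c) (out_kE b); exact: PremutComp.
case: (boolP (near tau k s)) => hn; last first.
  rewrite (_ : inl _ = pm_off (exist _ (s : Qtau) (off_away hn))); first exact: PremutAway.
  by congr (inl (inl _)); apply: val_inj.
rewrite (_ : inl _ = pm_off (base_k (cw tau (cw tau s)).2)); first exact: PremutBase.
congr (inl (inl _)); apply: val_inj => /=; move: hs => /=.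
case: nearP hn => // c -> _; rewrite ?eqxx // ?cw_side2 ?eqxx ?andbF //.
Qed.

Definition sum_to_premut (y : Qsum) : premut_quiver Qtau k :=
  match y with
  | inr (c, true) => pm_off (base_k c)
  | inr (c, false) => pm_comp (out_k c) (in_k c)
  | inl s =>
      if s.1 == k then pm_star_in (in_k (~~ (e (+) s.2)))
      else if (cw tau (cw tau s)).1 == k then
        pm_star_out (out_k (cw tau (cw tau s)).2)
      else if (cw tau s).1 == k then
        pm_comp (out_k (~~ (cw tau s).2)) (in_k (cw tau s).2)
      else pm_off (insubd (base_k false) (s : Qtau))
  end.

Lemma premut_to_sum_bij : bijective premut_to_sum.
Proof.
exists sum_to_premut => [a|].
  case: (premutP a) => [c|s hs|b c|b|c].
  - by rewrite /= corner_arrow_p.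
  - have [n1 n2 n3] := not_near hs; rewrite /= corner_arrow_away //= n1 n2 n3.
    congr (inl (inl _)); apply: val_inj; rewrite val_insubd /=.
    by rewrite n1 n2.
  - rewrite /= cw_side2 /=; case: eqP => [->//|/eqP nbc] /=.
    rewrite (negbTE (side2_off _ _ _)) cw_side2 /= eqxx -/(p c) (negbTE (side1_off _ _ _)).
    by case: b c nbc => [] [].
  - by rewrite /= -/(p b) (negbTE (side1_off _ _ _)) -/(q b) cw_side2 /= eqxx.
  - by rewrite /= cw_side2 /= eqxx addKb negbK.
case=> [s|[c []]] /=; last by rewrite cw_side2 /= eqxx.
  case: (boolP (near tau k s)) => hn.
    case: nearP hn => // c -> _.
    - by rewrite /= eqxx /= cw_side2 /= negbK /new_side addKb.
    - by rewrite (negbTE (side1_off _ _ _)) -/(q c) cw_side2 eqxx.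
    - rewrite (negbTE (side2_off _ _ _)) cw_side2 -/(p c) (negbTE (side1_off _ _ _)).
      by rewrite eqxx /= cw_side2 /=; case: (c).
  have [-> -> ->] := not_near hn.
  by rewrite /= val_insubd (off_away hn) corner_arrow_away.
by rewrite corner_arrow_p.
Qed.

Lemma premut_to_sum_src a : src (premut_to_sum a) = src a.
Proof.
case: (premutP a) => [c|s hs|b c|b|c] /=.
- by rewrite corner_arrow_p.
- by rewrite corner_arrow_away.
- by rewrite cw_side2 /=; case: eqP => [->|].
- by [].
- by rewrite cw_side2.
Qed.

Lemma premut_to_sum_tgt a : tgt (premut_to_sum a) = tgt a.
Proof.
case: (premutP a) => [c|s hs|b c|b|c] /=.
- by rewrite corner_arrow_p.
- by rewrite corner_arrow_away //= cw_sigma.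
- rewrite cw_side2 /=; case: eqP => [->//|/eqP nbc] /=.
  by rewrite cw_sigma_q; case: b c nbc => [] [].
- by rewrite -/(p b) cw_sigma_p.
- by rewrite cw_side2 cw_new negbK.
Qed.

(** The path of [Q(tau)] that an arrow of the sum stands for; the arrows that
    correspond to reversed arrows stand for none. *)
Definition decode (y : Qsum) : option (seq Qtau) :=
  match y with
  | inl s => if near tau k s && ((cw tau s).1 != k) then None
             else Some (corners tau k s)
  | inr (c, false) => Some [:: q c; (k, c)]
  | inr (c, true) => Some [:: p c]
  end.

Lemma corners_p c : corners tau k (p c) = [:: p c].
Proof. by rewrite /corners -/(q c) (negbTE (side2_off _ _ _)). Qed.

Lemma corners_q c : corners tau k (q c) = [:: q c; (k, ~~ c)].
Proof. by rewrite /corners /arrow_g cw_side2 eqxx. Qed.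

Lemma corners_away s : ~~ near tau k s -> corners tau k s = [:: s].
Proof. by rewrite /corners; case: nearP => // _ /negbTE->. Qed.

Lemma decode_premut : @expand _ Qtau k = decode \o premut_to_sum.
Proof.
apply/funext => a; case: (premutP a) => [c|s hs|b c|b|c] /=.
- by rewrite corner_arrow_p.
- by rewrite corner_arrow_away //= (negbTE hs) corners_away.
- rewrite cw_side2 /=; case: eqP => [->//|/eqP nbc] /=.
  rewrite cw_side2 eqxx andbF corners_q; by case: b c nbc => [] [].
- by rewrite -/(p b) near_side1 /= -/(q b) side2_off.
- by rewrite /near eqxx /= -/(p _) side1_off.
Qed.

Lemma decode_code : path_code decode.
Proof.
split=> [[s|[c []]] t|] /=.
- case: ifP => // hs [<-].
  case: (boolP (near tau k s)) hs => [|hn _]; last first.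
    by rewrite corners_away //= eqxx /wend /= cw_sigma.
  case: nearP => // c -> _; rewrite -?/(p _) -?/(q _) ?side1_off ?side2_off //= cw_side2.
  by rewrite eqxx corners_q /= cw_side2 !eqxx /wend /= cw_sigma_q.
- by case=> <-; rewrite /= eqxx.
- by case=> <-; rewrite /= cw_side2 !eqxx.
have headE y t : decode y = Some t ->
    (exists s, [/\ t = [:: s], (cw tau s).1 != k & y = corner_arrow s]) \/
    exists c, (t = [:: q c; (k, ~~ c)] /\ y = new_arrow (q c)) \/
              (t = [:: q c; (k, c)] /\ y = old_comp c).
  case: y => [s|[c []]] /=.
  - case: ifP => // hs [<-].
    case: (boolP (near tau k s)) hs => [|hn _]; last first.
      left; exists s; rewrite corners_away // corner_arrow_away //.
      by split=> //; case: nearP hn.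
    case: nearP => // c -> _; rewrite -?/(p _) -?/(q _) ?side1_off ?side2_off //= cw_side2.
    by rewrite eqxx corners_q => _; right; exists c; left.
  - by case=> <-; left; exists (p c); rewrite -/(q c) side2_off corner_arrow_p.
  - by case=> <-; right; exists c; right.
have qk c s : q c = s -> (cw tau s).1 != k -> False.
  by move=> <-; rewrite cw_side2 eqxx.
move=> y y' t t' u u' /headE h /headE h'.
case: h => [[s [-> ks ->]]|[c h]]; case: h' => [[s' [-> ks' ->]]|[c' h']].
- by case=> ->.
- by case: h' => -[-> _] [/esym/qk/(_ ks)].
- by case: h => -[-> _] [/qk/(_ ks')].
by case: h h' => -[-> ->] [] [-> ->] // [/(@side2_inj _ _ tau k) ->] // [];
  case: (c').
Qed.
(** ** The change of variables *)

(** The path of [Q(sigma)] parallel to [old_base c], through the new arc. *)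
Definition u_word c : seq Qsum := [:: new_arrow (p c); new_arrow (r (~~ c))].
Definition u c : cpalg K Qsum := pth K (p c).1 (u_word c).

Lemma u_from_to c : from_to (src (old_base c)) (tgt (old_base c)) (u c).
Proof.
have -> : tgt (old_base c) = wend (Q := Qsum) (p c).1 (u_word c).
  by rewrite /wend /= cw_new negbK.
exact: from_to_pth.
Qed.

Lemma old_base_ends c : src (old_base c) != tgt (old_base c).
Proof. by have := cw_arc tau (p c); rewrite eq_sym. Qed.

Lemma u_in_m c : in_mpow 1 (u c).
Proof. have h := @u_from_to c; exact: from_to_in_m (old_base_ends c) h. Qed.

Definition not_base (y : Qsum) : bool := if y is inr (_, true) then false else true.
Definition not_comp (y : Qsum) : bool := if y is inr (_, false) then false else true.

Lemma baseP y : ~~ not_base y -> exists c, y = old_base c.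
Proof. by case: y => [s|[c []]] // _; exists c. Qed.

(** This absorbs the term [u c * arr (old_comp c)] of the potential into
    [arr (old_base c) * arr (old_comp c)]. *)
Lemma base_change : exists phi : {rmorphism cpalg K Qsum -> cpalg K Qsum},
  [/\ bijective phi, fixes_vertices phi,
      forall c, phi (arr (old_base c)) = arr (old_base c) - u c
    & forall x, supported not_base x -> phi x = x].
Proof.
pose D (y : Qsum) : cpalg K Qsum := if y is inr (c, true) then - u c else 0.
have [||||phi [phi_bij phi_v phi_a phi_id]] := triangular_automorphism (B := not_base) (D := D).
- case=> [s|[c []]]; [exact: from_to0 | exact/from_toN/u_from_to | exact: from_to0].
- case=> [s|[c []]]; [exact: in_mpow0 | exact/in_mpowN/u_in_m | exact: in_mpow0].
- by case=> [s|[c []]].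
- case=> [s|[c []]]; [exact: supported0 | | exact: supported0].
  by apply/supportedN/supported_pth.
by exists phi; split=> // c; apply: phi_a.
Qed.

(** As [old_comp c] occurs in [arr (old_base c) * arr (old_comp c)] only, this
    removes the terms [arr (old_base c) * F c] from the potential and changes
    nothing else. *)
Lemma comp_change (F : bool -> cpalg K Qsum) :
  (forall c, from_to (src (old_comp c)) (tgt (old_comp c)) (F c)) ->
  (forall c, supported not_comp (F c)) ->
  exists phi : {rmorphism cpalg K Qsum -> cpalg K Qsum},
  [/\ bijective phi, fixes_vertices phi,
      forall c, phi (arr (old_comp c)) = arr (old_comp c) - F c
    & forall x, supported not_comp x -> phi x = x].
Proof.
move=> Fft Fs.
pose D (y : Qsum) : cpalg K Qsum := if y is inr (c, false) then - F c else 0.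
have [||||phi [phi_bij phi_v phi_a phi_id]] := triangular_automorphism (B := not_comp) (D := D).
- case=> [s|[c []]]; [exact: from_to0 | exact: from_to0 | exact/from_toN/Fft].
- case=> [s|[c []]]; [exact: in_mpow0 | exact: in_mpow0 |].
  by apply/in_mpowN/(from_to_in_m _ (Fft c)); rewrite eq_sym; apply: old_base_ends.
- by case=> [s|[c []]].
- case=> [s|[c []]]; [exact: supported0 | exact: supported0 |].
  exact/supportedN/Fs.
by exists phi; split=> // c; apply: phi_a.
Qed.

(** The part of the first change of variables that is free of the arrows
    [old_base c]. *)
Lemma base_substitution : exists zeta : {rmorphism cpalg K Qsum -> cpalg K Qsum},
  [/\ fixes_vertices zeta, forall c, zeta (arr (old_base c)) = - u c
    & forall y, not_base y -> zeta (arr y) = arr y].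
Proof.
pose F (y : Qsum) : cpalg K Qsum := if y is inr (c, true) then - u c else arr y.
have [||zeta [zeta_v zeta_a]] := subst_exists (F := F).
- by case=> [s|[c []]]; [exact: from_to_arr | exact/from_toN/u_from_to | exact: from_to_arr].
- by case=> [s|[c []]]; [exact: arr_in_m | exact/in_mpowN/u_in_m | exact: arr_in_m].
exists zeta; split=> [|c|y]; [exact: zeta_v | exact: zeta_a |].
by rewrite zeta_a; case: y => [s|[c []]].
Qed.

Lemma base_morph (phi : {rmorphism cpalg K Qsum -> cpalg K Qsum})
    (z : bool -> cpalg K Qsum) :
  fixes_vertices phi -> (forall c, phi (arr (old_base c)) = z c) ->
  (forall y, not_base y -> phi (arr y) = arr y) ->
  (forall c, from_to (src (old_base c)) (tgt (old_base c)) (z c)) ->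
  (forall c, supported not_comp (z c)) ->
  [/\ forall a, from_to (src a) (tgt a) (phi (arr a)),
      forall a, not_comp a -> supported not_comp (phi (arr a))
    & forall v (s : seq Qsum), from_to v (wend v s) (phi (pth K v s)) /\
        (all not_comp s -> supported not_comp (phi (pth K v s)))].
Proof.
move=> phi_v phi_b phi_n z_ft z_s.
have phi_ft a : from_to (src a) (tgt a) (phi (arr a)).
  by case: (boolP (not_base a)) => [/phi_n->|/baseP[c ->]];
    [exact: from_to_arr | rewrite phi_b].
have phi_s a : not_comp a -> supported not_comp (phi (arr a)).
  move=> ha; case: (boolP (not_base a)) => [/phi_n->|/baseP[c ->]]; last by rewrite phi_b.
  by apply: supported_pth; rewrite /= ha.
split=> // v s; exact: morph_pth.
Qed.

(** The two homomorphisms differ by [arr (old_base c)] on [old_base c] and agree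
    on the other arrows. Replacing the letters of a cycle one at a time, the
    difference of their values is a sum of terms in which some [old_base c] can be
    rotated to the front. The factor [y] stands for the letters that have been
    replaced already. *)
Lemma telescope (phi zeta : {rmorphism cpalg K Qsum -> cpalg K Qsum}) :
  fixes_vertices phi -> fixes_vertices zeta ->
  (forall c, phi (arr (old_base c)) = arr (old_base c) - u c) ->
  (forall y, not_base y -> phi (arr y) = arr y) ->
  (forall c, zeta (arr (old_base c)) = - u c) ->
  (forall y, not_base y -> zeta (arr y) = arr y) ->
  forall (s : seq Qsum) v y, all not_comp s ->
  from_to (wend v s) v y -> supported not_comp y ->
  supported not_comp (phi (pth K v s)) /\
  exists F : bool -> cpalg K Qsum,
    [/\ forall c, from_to (src (old_comp c)) (tgt (old_comp c)) (F c),
        forall c, supported not_comp (F c)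
      & cyc_equiv ((phi (pth K v s) - zeta (pth K v s)) * y)
          (\sum_c arr (old_base c) * F c)].
Proof.
move=> phi_v zeta_v phi_b phi_n zeta_b zeta_n.
have supp_u c : supported not_comp (u c) by apply: supported_pth.
have supp_base c : supported not_comp (arr (old_base c) : cpalg K Qsum).
  exact: supported_pth.
have [phi_ft _ phi_pth] : [/\ forall a, from_to (src a) (tgt a) (phi (arr a)),
    forall a, not_comp a -> supported not_comp (phi (arr a))
  & forall v (s : seq Qsum), from_to v (wend v s) (phi (pth K v s)) /\
      (all not_comp s -> supported not_comp (phi (pth K v s)))].
  apply: (base_morph phi_v phi_b phi_n) => c.
    by apply: from_toD; [exact: from_to_arr | exact/from_toN/u_from_to].
  by apply: supportedD => //; apply: supportedN.
have [zeta_ft zeta_s _] : [/\ forall a, from_to (src a) (tgt a) (zeta (arr a)),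
    forall a, not_comp a -> supported not_comp (zeta (arr a))
  & forall v (s : seq Qsum), from_to v (wend v s) (zeta (pth K v s)) /\
      (all not_comp s -> supported not_comp (zeta (pth K v s)))].
  apply: (base_morph zeta_v zeta_b zeta_n) => c; first exact/from_toN/u_from_to.
  exact: supportedN.
have zero (z : cpalg K Qsum) : z = 0 -> exists F : bool -> cpalg K Qsum,
    [/\ forall c, from_to (src (old_comp c)) (tgt (old_comp c)) (F c),
        forall c, supported not_comp (F c)
      & cyc_equiv z (\sum_c arr (old_base c) * F c)].
  move=> ->; exists (fun=> 0); split=> [c|c|]; [exact: from_to0 | exact: supported0 |].
  rewrite big1 => [|c _]; [exact: cyc_refl | exact: mulr0].
move=> s v y hs hy ys; split; first exact: (phi_pth v s).2.
elim: s v y hs hy ys => [|a s IHs] v y hs hy ys.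
  by apply: zero; rewrite pth0E phi_v zeta_v subrr mul0r.
have [ea|ne] := eqVneq (src a) v; last first.
  by apply: zero; rewrite pth_off /= ?(negbTE ne) // !rmorph0 subrr mul0r.
case/andP: hs => ha hs; rewrite -{v}ea in hy *.
have hza : from_to (wend (tgt a) s) (tgt a) (zeta (arr a) * y).
  exact: from_toM (zeta_ft a) hy.
have [|F [Fft Fs hF]] := IHs (tgt a) _ hs hza; first by apply: supportedM; first exact: zeta_s.
have -> : (phi (pth K (src a) (a :: s)) - zeta (pth K (src a) (a :: s))) * y
    = (phi (pth K (tgt a) s) - zeta (pth K (tgt a) s)) * (zeta (arr a) * y)
      + phi (pth K (tgt a) s) * ((phi (arr a) - zeta (arr a)) * y).
  by rewrite pth_cons !rmorphM !mulrBl mulrBr !mulrA [RHS]addrC subrKA.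
have [ps_ft ps_s] := phi_pth (tgt a) s.
case: (boolP (not_base a)) => hb.
  exists F; split=> //; rewrite phi_n // zeta_n // subrr mul0r mulr0 addr0.
  by rewrite zeta_n // in hF.
have [c ec] := baseP hb.
have -> : phi (arr a) - zeta (arr a) = arr a by rewrite ec phi_b zeta_b opprK subrK.
pose F' d := if d == c then y * phi (pth K (tgt a) s) else 0.
exists (fun d => F d + F' d); split=> [d|d|].
- apply: from_toD => //; rewrite /F'; case: eqP => [->|_]; last exact: from_to0.
  by rewrite ec in hy ps_ft *; apply: from_toM hy ps_ft.
- apply: supportedD => //; rewrite /F'; case: eqP => _; last exact: supported0.
  by apply: supportedM => //; apply: ps_s.
have -> : \sum_d arr (old_base d) * (F d + F' d)
    = \sum_d arr (old_base d) * F d + arr a * (y * phi (pth K (tgt a) s)).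
  under eq_bigr do rewrite mulrDr; rewrite big_split /=; congr (_ + _).
  rewrite (bigD1 c) //= big1 ?addr0 => [|d nd]; first by rewrite /F' eqxx ec.
  by rewrite /F' (negbTE nd) mulr0.
apply: cycD => //; rewrite [X in cyc_equiv _ X]mulrA.
by have h := @from_to_arr K _ _ a; apply: (cyc_mulC ps_ft); exact: from_toM h hy.
Qed.

Definition split_corner s : bool := (cw tau (cw tau s)).1 == k.

(** Substituting [- u c] for [old_base c] turns the corners of [tau] into those
    of [sigma], up to sign. *)
Lemma zeta_word (zeta : {rmorphism cpalg K Qsum -> cpalg K Qsum}) :
  fixes_vertices zeta -> (forall c, zeta (arr (old_base c)) = - u c) ->
  (forall y, not_base y -> zeta (arr y) = arr y) ->
  forall L v, (forall s, s \in L -> s.1 != k) ->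
  zeta (pth K v (map corner_arrow L)) = (-1) ^+ count split_corner L *:
    pth K v (map new_arrow (flatten (map (corners sigma k) L))).
Proof.
move=> zeta_v zeta_b zeta_n; elim=> [|s L IHL] v hL.
  by rewrite /= expr0 scale1r pth0E zeta_v -pth0E.
have {}IHL w := IHL w (fun t ht => hL t (mem_behead (s := s :: L) ht)).
have hs : s.1 != k by apply: hL; rewrite mem_head.
have step : src (corner_arrow s) = s.1 /\ zeta (arr (corner_arrow s))
    = (-1) ^+ split_corner s *: pth K s.1 (map new_arrow (corners sigma k s)) /\
    tgt (corner_arrow s) = wend (Q := Qsum) s.1 (map new_arrow (corners sigma k s)).
  case: (boolP (near tau k s)) => hn; last first.
    have [n1 n2 n3] := not_near hn; rewrite corner_arrow_away // zeta_n //.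
    by rewrite /split_corner /corners n3 cw_sigma // n2 scale1r.
  case: nearP hn hs => // c -> _; rewrite ?eqxx // => _.
    rewrite corner_arrow_p zeta_b /split_corner -/(q c) cw_side2 eqxx expr1 scaleN1r.
    rewrite /corners cw_sigma_p eqxx /arrow_g cw_sigma_p.
    have -> : opp (r c) = r (~~ c) by rewrite /opp /= /new_side addbN.
    by rewrite /wend /= cw_new negbK.
  rewrite corner_arrow_q zeta_n // /split_corner cw_side2 -/(p c).
  by rewrite (negbTE (side1_off _ _ _)) scale1r /corners cw_sigma_q (negbTE (side1_off _ _ _))
    /wend /= cw_sigma_q.
have [es [ez et]] := step; rewrite /= map_cat.
have [->|nv] := eqVneq v s.1; last first.
  rewrite pth_off ?rmorph0; last first.
    by apply/negP; case/andP=> /eqP; rewrite es => ev; rewrite ev eqxx in nv.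
  rewrite pth_off ?scaler0 // /corners.
  by case: ifP => _ /=; rewrite eq_sym (negbTE nv).
rewrite -{1}es pth_cons rmorphM IHL ez cp_scaleAl cp_scaleAr scalerA -exprD addnC.
by rewrite pthM et eqxx.
Qed.

(** Each turn around the puncture passes each of the two arrows [old_base c]
    once. This is an even number, so the signs in [zeta_word] cancel. *)
Lemma count_split_corner s n : s.1 != k ->
  count split_corner (puncture_word tau k s n) = (n * 2)%N.
Proof.
move=> hs; have [_ uL mL] := puncture_walk tau hs.
rewrite /puncture_word; elim: n => //= n IHn; rewrite count_cat {}IHn mulSn.
congr (_ + _)%N; rewrite -size_filter -(card_uniqP _) ?filter_uniq //.
rewrite -card_bool -(card_codom (@side1_inj _ _ tau k)); apply: eq_card => t.
rewrite mem_filter mL !inE /split_corner; apply/andP/codomP => [[/eqP h _]|[c ->]].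
  have [c hc] := cw_eq_k h; exists c; apply: (@cw_inj _ _ tau); exact: hc.
by rewrite -/(q c) cw_side2 eqxx side1_off.
Qed.
(** ** The premutation and the new potential *)

Variables (x : K) (n : nat) (s0 : side I).
Hypothesis hn : (0 < n)%N.
Hypothesis s0_off : s0.1 != k.

Let L := puncture_word tau k s0 n.
Let R := froots (@arrow_f g I tau).

Lemma L_off s : s \in L -> s.1 != k.
Proof.
move=> /flattenP[t /nseqP[-> _]]; exact: traject_turn_without_off.
Qed.

(** The representative of the potential of [tau] to which the premutation
    applies. *)
Definition shifted_S : cpalg K Qtau :=
  \sum_c triangle_cycle tau (q c) + \sum_(s | ~~ near tau k s && R s) triangle_cycle tau s
  + x *: pth K s0.1 (flatten (map (corners tau k) L) : seq Qtau).

(** The 3-cycles of [Q(sigma)], which both changes of variables fix. *)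
Definition unchanged : cpalg K Qsum :=
  \sum_c pth K (q c).1 (map new_arrow [:: q c; p (~~ c); r (~~ c)])
  + \sum_(s | ~~ near tau k s && R s) pth K s.1 (map new_arrow (triangle_word sigma s)).

Lemma decode_pth v (t : seq Qsum) (w : seq Qtau) :
  all (fun y => isSome (decode y)) t -> flatten (pmap decode t) = w ->
  reindex decode (pth K v w) = pth K v t.
Proof. by move=> ht <-; exact: (reindex_pth decode_code). Qed.

(** A word of corners of the surface without [k] is a path both of [Q(tau)] and of
    the sum, and this is how they correspond. *)
Lemma decode_corners (M : seq (side I)) : (forall s, s \in M -> s.1 != k) ->
  all (fun y => isSome (decode y)) (map corner_arrow M) /\
  flatten (pmap decode (map corner_arrow M)) = flatten (map (corners tau k) M).
Proof.
elim: M => //= s M IHM hM; have [|-> IH] := IHM.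
  by move=> t ht; apply: hM; rewrite inE ht orbT.
have -> : decode (corner_arrow s) = Some (corners tau k s); last by rewrite /= IH.
have hs : s.1 != k by apply: hM; rewrite mem_head.
case: (boolP (near tau k s)) => h; last by rewrite corner_arrow_away //= (negbTE h).
case: nearP h hs => // c -> _; rewrite ?eqxx // => _.
  by rewrite corner_arrow_p corners_p.
by rewrite corner_arrow_q /= cw_side2 eqxx andbF.
Qed.

Lemma decode_shifted_S : reindex decode shifted_S =
  \sum_c arr (old_base c) * arr (old_comp c)
  + \sum_(s | ~~ near tau k s && R s) pth K s.1 (map new_arrow (triangle_word sigma s))
  + x *: pth K s0.1 (map corner_arrow L).
Proof.
rewrite /shifted_S !reindexD !reindex_sum reindexZ; congr (_ + _ + _ *: _).
- apply: eq_bigr => c _.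
  rewrite (@decode_pth _ [:: old_comp c; old_base c]) //; last first.
    by rewrite /triangle_word cw_side2 -/(p c).
  by rewrite -[(q c).1]/(src (old_comp c)) pth_cons.
- apply: eq_bigr => s /andP[hs _]; apply: decode_pth.
    by rewrite /= !cw_sigma ?near_cw // (negbTE hs).
  rewrite /= !cw_sigma ?near_cw // (negbTE hs) /=.
  by rewrite !corners_away ?near_cw.
- by have [h1 h2] := decode_corners L_off; apply: decode_pth.
Qed.

Lemma sum_arrow_out (F : arrow_out Qtau k -> cpalg K Qsum) :
  \sum_b F b = \sum_c F (out_k c).
Proof.
rewrite (bigop.reindex out_k) //; apply: onW_bij.
by exists (fun b => (val b).2) => // b; rewrite -out_kE.
Qed.

Lemma sum_arrow_in (F : arrow_in Qtau k -> cpalg K Qsum) :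
  \sum_b F b = \sum_c F (in_k c).
Proof.
rewrite (bigop.reindex in_k) //; apply: onW_bij.
by exists (fun b => (cw tau (val b)).2) => b; rewrite -?in_kE //= cw_side2.
Qed.

(** The sum over pairs of arrows at [k] splits: the composites of two arrows of the
    same triangle give the terms [u c * arr (old_comp c)], the others give the
    3-cycles of [sigma] at the new arc. *)
Lemma premut_image (rho : {rmorphism cpalg K (premut_quiver Qtau k) -> cpalg K Qsum}) :
  (forall v (s : seq (premut_quiver Qtau k)),
     rho (pth K v s) = pth K v (map premut_to_sum s)) ->
  (forall (S : cpalg K Qtau), rho (reindex (decode \o premut_to_sum : premut_quiver Qtau k -> _) S)
     = reindex decode S) ->
  rho (premut_pot k shifted_S) =
    \sum_c (arr (old_base c) + u c) * arr (old_comp c) + unchanged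
    + x *: pth K s0.1 (map corner_arrow L).
Proof.
move=> rho_pth rho_re; rewrite /premut_pot rmorphD decode_premut rho_re decode_shifted_S.
set Z := (X in _ + X).
have -> : Z = \sum_c (u c * arr (old_comp c)
    + pth K (q c).1 (map new_arrow [:: q c; p (~~ c); r (~~ c)])).
  rewrite /Z rmorph_sum sum_arrow_out.
  under eq_bigr do rewrite rmorph_sum sum_arrow_in.
  rewrite exchange_big; apply: eq_bigr => c _.
  have -> (F : bool -> cpalg K Qsum) : \sum_b F b = F c + F (~~ c).
    by rewrite big_bool; case: c => //; rewrite addrC.
  pose w b : seq (premut_quiver Qtau k) :=
    [:: pm_comp (out_k b) (in_k c); pm_star_out (out_k b); pm_star_in (in_k c)].
  transitivity (pth K (q c).1 (map premut_to_sum (w c))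
    + pth K (q c).1 (map premut_to_sum (w (~~ c)))).
    by congr (_ + _); apply: rho_pth.
  rewrite /w /= !cw_side2 /= eqxx.
  have -> : (~~ c == c) = false by case: (c).
  by rewrite -[(q c).1]/(src (old_comp c)) pth_cons.
rewrite big_split /unchanged /=; under [in RHS]eq_bigr do rewrite mulrDl.
rewrite [in RHS]big_split /= -!addrA; congr (_ + _).
by rewrite [LHS]addrA addrC -!addrA.
Qed.

Lemma sigma_normal (b : Qsigma) :
  cyc_equiv (reindex (@as_left I Qsigma old_triangles) (surface_S x n b)
             + reindex (@as_right I Qsigma old_triangles) (qp_pot old_triangles))
    (\sum_c arr (old_base c) * arr (old_comp c) + unchanged
     + x *: pth K s0.1 (map new_arrow (flatten (map (corners sigma k) L)))).
Proof.
have [||||left_pth left_cyc] := @cyc_reindex K I Qsigma Qsum new_arrow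
  (@as_left I Qsigma old_triangles) => //.
  by case=> // a s [<-]; exists a.
have [||||right_pth _] := @cyc_reindex K I old_triangles Qsum inr
  (@as_right I Qsigma old_triangles) => //.
  by case=> // a s [<-]; exists a.
have hR : transversal sigma [pred s | ~~ near sigma k s] R.
  move=> s; rewrite /= near_flip => hs.
  by rewrite !cw_sigma ?near_cw //; apply: (@froots_transversal _ _ tau predT s).
have EL : puncture_word sigma k s0 n = L.
  by rewrite /L /puncture_word without_sigma.
have N : cyc_equiv (surface_S x n b)
    (\sum_c triangle_cycle sigma (q c)
     + \sum_(s | ~~ near tau k s && R s) triangle_cycle sigma s
     + x *: pth K s0.1 (flatten (map (corners sigma k) L) : seq Qsigma)).
  apply: cyc_trans (surface_S_normal b x hn hR s0_off) _; rewrite EL.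
  apply: cycD; last exact: cyc_refl.
  apply: cycD; last by under eq_bigl do rewrite near_flip; apply: cyc_refl.
  have inj : injective (fun c => e (+) ~~ c).
    by move=> c d /(can_inj (addKb e))/(can_inj negbK).
  rewrite (reindex_inj inj); apply: cyc_sum => c _.
  by rewrite side2_sigma -cw_sigma_q; apply/cyc_sym/cyc_triangle.
apply: cyc_trans (cycD (left_cyc _ _ N) (cyc_refl _)) _.
rewrite !reindexD !reindex_sum reindexZ left_pth /unchanged.
have E1 c : reindex (@as_left I Qsigma old_triangles) (triangle_cycle sigma (q c))
    = pth K (q c).1 (map new_arrow [:: q c; p (~~ c); r (~~ c)]).
  by rewrite left_pth /triangle_word cw_sigma_q cw_sigma_p.
have E2 c : reindex (@as_right I Qsigma old_triangles)
    (pth K (q c).1 (two_cycle_word _ _ c)) = arr (old_base c) * arr (old_comp c).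
  by rewrite right_pth -[(q c).1]/(src (old_comp c)) pth_cons.
rewrite (eq_bigr _ (fun c _ => E1 c)) (eq_bigr _ (fun c _ => E2 c)).
have E3 s : reindex (@as_left I Qsigma old_triangles) (triangle_cycle sigma s)
    = pth K s.1 (map new_arrow (triangle_word sigma s)) by exact: left_pth.
rewrite (eq_bigr _ (fun s _ => E3 s)).
by rewrite addrC !addrA; apply: cyc_refl.
Qed.

Lemma premut_equiv (b : Qsigma) (hS : is_potential shifted_S) :
  right_equiv (MkQP (premut_potP (k := k) hS)) (qp_sum (surface_QP x hn b) old_triangles).
Proof.
have [rho [rho_bij rho_v rho_pth rho_re]] := @renaming_isomorphism K _ _ _
  _ premut_to_sum_bij premut_to_sum_src premut_to_sum_tgt.
have [phi [phi_bij phi_v phi_b phi_id]] := base_change.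
have [zeta [zeta_v zeta_b zeta_n]] := base_substitution.
pose W := pth K s0.1 (map corner_arrow L).
pose W' := pth K s0.1 (map new_arrow (flatten (map (corners sigma k) L))).
have phi_n y : not_base y -> phi (arr y) = arr y.
  by move=> hy; apply: phi_id; apply: supported_pth; rewrite /= hy.
have L_comp : all not_comp (map corner_arrow L).
  by rewrite all_map; apply/allP => s _; rewrite /= /corner_arrow; case: ifP.
have L_end : wend s0.1 (map corner_arrow L) = s0.1.
  have [h1 h2] := decode_corners L_off.
  have /and3P[_ hw /eqP he] := puncture_word_is_cycle tau hn s0_off.
  by rewrite -(wend_decode decode_code h1) ?h2 // -(walk_decode decode_code _ h1) h2.
have zeta_W : zeta W = W'.
  rewrite /W (zeta_word zeta_v zeta_b zeta_n _ L_off) count_split_corner //.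
  by rewrite mulnC exprM sqrrN expr1n expr1n scale1r.
have [||phiW [F [Fft Fs]]] := telescope phi_v zeta_v phi_b phi_n zeta_b zeta_n
  (s := map corner_arrow L) (v := s0.1) (y := pth K s0.1 [::]) L_comp.
- by rewrite L_end; apply: (@from_to_pth _ _ _ s0.1 [::]).
- exact: supported_pth.
rewrite -/W in phiW *.
have idr (chi : {rmorphism cpalg K Qsum -> cpalg K Qsum}) :
    fixes_vertices chi -> chi W * pth K s0.1 [::] = chi W.
  by move=> chi_v; rewrite pth0E -chi_v -rmorphM -pth0E /W pthM eqxx.
rewrite mulrBl !idr // zeta_W => hF.
have [||psi [psi_bij psi_v psi_c psi_id]] := comp_change (F := fun c => x *: F c).
- by move=> c; apply: from_toZ.
- by move=> c; apply: supportedZ.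
have un (B : pred Qsum) : (forall s, B (new_arrow s)) -> supported B unchanged.
  move=> hB; apply: supportedD; apply: big_ind => [|y z|i _]; try exact: supported0;
    try exact: supportedD; apply: supported_pth; by rewrite /= !hB.
have image_pot : psi (phi (rho (premut_pot k shifted_S)))
    = \sum_c arr (old_base c) * (arr (old_comp c) - x *: F c) + unchanged + x *: phi W.
  rewrite (premut_image rho_pth (rho_re Qtau decode)).
  rewrite (rmorphD phi (_ + unchanged)) (rmorphD phi _ unchanged).
  rewrite (morph_scale _ _ phi_v) (phi_id unchanged); last exact: un.
  rewrite (rmorphD psi (_ + unchanged)) (rmorphD psi _ unchanged).
  rewrite (morph_scale _ _ psi_v) (psi_id unchanged); last exact: un.
  rewrite (psi_id (phi W)) ?phiW //; congr (_ + _ + _).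
  rewrite (rmorph_sum phi) (rmorph_sum psi); apply: eq_bigr => c _.
  rewrite !rmorphM /= rmorphD phi_b (phi_id (u c)) ?subrK; last exact: supported_pth.
  by rewrite phi_n // psi_c psi_id //; apply: supported_pth.
have drop_base : cyc_equiv (phi W - \sum_c arr (old_base c) * F c) W'.
  have := cycD hF (cyc_refl (W' - \sum_c arr (old_base c) * F c)).
  by rewrite subrKA [X in cyc_equiv _ X]addrC subrK.
have main : cyc_equiv (psi (phi (rho (premut_pot k shifted_S))))
    (qp_pot (qp_sum (surface_QP x hn b) old_triangles)).
  rewrite image_pot; apply: (cyc_trans _ (cyc_sym (sigma_normal b))).
  have -> : \sum_c arr (old_base c) * (arr (old_comp c) - x *: F c) + unchanged + x *: phi W
      = \sum_c arr (old_base c) * arr (old_comp c) + unchanged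
        + x *: (phi W - \sum_c arr (old_base c) * F c).
    have -> : \sum_c arr (old_base c) * (arr (old_comp c) - x *: F c)
        = \sum_c arr (old_base c) * arr (old_comp c) - x *: \sum_c arr (old_base c) * F c.
      by rewrite scaler_sumr -sumrB; apply: eq_bigr => c _; rewrite mulrBr cp_scaleAr.
    by rewrite scalerBr (addrAC _ (- _) unchanged) -[LHS]addrA; congr (_ + _); rewrite addrC.
  by apply: cycD; [exact: cyc_refl | exact: cycZ].
exists (psi \o (phi \o rho))%FUN; split=> [|c|]; last exact: main.
  by apply: bij_comp => //; apply: bij_comp.
by rewrite /= rho_v phi_v psi_v.
Qed.

Lemma shifted_S_potential : is_potential shifted_S.
Proof.
apply: potD; last by apply/potZ/pot_pth/puncture_word_is_cycle.
by apply: potD; apply: pot_sum => s _; apply/pot_pth/triangle_is_cycle.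
Qed.

Lemma shifted_S_avoids_start : avoids_start k shifted_S.
Proof.
have off v (w : seq Qtau) t : v != k -> pth K v w k t = 0.
  by move=> nv; rewrite coef_pth -pair_eqE /= eq_sym (negbTE nv) andbF.
move=> t; rewrite !cp_coefD !cp_coef_sum cp_coefZ off // mulr0 addr0.
rewrite !big1 ?addr0 // => [s /andP[hs _]|c _]; apply: off; last exact: side2_off.
by case: nearP hs.
Qed.

End FlippedArc.

Theorem theorem1p2 (K : fieldType) (g : nat) (hg : (0 < g)%N) (I : finType)
    (tau sigma : triangulation g I) (k : I) (hflip : flip k tau sigma)
    (x : K) (n : nat) (hn : (0 < n)%N)
    (a : surface_quiver tau) (b : surface_quiver sigma) :
  exists P : QP K I,
    is_mutation k (surface_QP x hn a) P /\ right_equiv P (surface_QP x hn b).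
Proof.
have loops (rho : triangulation g I) : loop_free (surface_quiver rho).
  by move=> s; rewrite eq_sym; apply: cw_arc.
have [e [h1 h2 h3]] := flip_quadrilateral hflip.
have s0_off := side1_off tau k false.
exists (surface_QP x hn b); split; last first.
  by exists idfun; split=> //; [exists idfun | exact: cyc_refl].
split; [exact: loops | exact: surface_no_2cycle |].
exists (shifted_S x n (side1 tau k false)), (shifted_S_potential x hn s0_off); split.
- by apply: surface_S_normal s0_off => //; apply: froots_transversal.
- exact: shifted_S_avoids_start.
split.
- apply: potential_in_m2; last exact: qp_potP.
  exact: premut_loop_free (loops tau) (@surface_no_2cycle _ _ tau k).
- apply: potential_in_m3; last exact: qp_potP; first exact: loops.
  by move=> v; apply: surface_no_2cycle.
exists (@old_triangles K g I tau k); first exact: trivial_two_cycles.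
exact: (premut_equiv h1 h2 h3 (turn_without_flip hflip)).
Qed.
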